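(* Let $\xi$ be a countable ordinal and let $T^\xi_{ess\text{-}inc}$ be the Banach space defined in the context, with basis $(e_j)_{j\in\mathbb{N}}$. For every infinite $M\subset\mathbb{N}$, the space $T^\xi_{ess\text{-}inc}$ contains a $c_0$-tree of height $\omega^\xi$ supported by $(e_j)_{j\in M}$. In particular, the space generated by $(e_j)_{j\in M}$ (its closed linear span in $T^\xi_{ess\text{-}inc}$) is not Asymptotic $\ell_1$.
   Context: $\mathbb{N}=\{1,2,\dots\}$. For finite $s,t\subset\mathbb{N}$ write $s<t$ if one is empty or $\max s<\min t$; $n\le s$ means $n\le\min s$. Schreier families: $\mathcal S_0=\{\{n\}:n\in\mathbb{N}\}\cup\{\emptyset\}$; $\mathcal S_{\alpha+1}=\{\emptyset\}\cup\{\bigcup_{j=1}^nE_j: n\in\mathbb{N},\ E_1<\dots<E_n \text{ nonempty in }\mathcal S_\alpha,\ n\le E_1\}$; for limit $\alpha$, fix a sequence $(\alpha_j)_j\subset[1,\alpha)$ increasing to $\alpha$ and let $\mathcal S_\alpha=\{E: \exists j\in\mathbb{N},\ E\in\mathcal S_{\alpha_j},\ j\le E\}$. Parameters: increasing sequences of naturals $(m_j)_{j\ge0},(n_j)_{j\ge0}$ with $m_0=2$, $m_1=4$, $m_j\ge m_{j-1}^2$ for $j\ge2$; $n_0=1$, $n_1=6$, $n_j>\log_2 m_j^2+n_{j-1}$ for $j\ge2$. $\mathcal Q$ is the set of finite sequences $((g_1,m_{j_1}),\dots,(g_k,m_{j_k}))$ with $g_i:\mathbb{N}\to\{-1,0,1\}$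 finitely supported, $j_i\in\mathbb{N}$, $m_{j_1}<\dots<m_{j_k}$; $\sigma:\mathcal Q\to\{m_j:j\in\mathbb{N}\}$ is a fixed injection with $\sigma((g_1,m_{j_1}),\dots,(g_k,m_{j_k}))>m_{j_k}$. Trees: $\widetilde{\mathcal T}_\xi$ is the set of finite sequences $((g_1,m_{j_1}),\dots,(g_k,m_{j_k}))$, $k\ge1$, with (i) $g_i:\mathbb{N}\to\{-1,0,1\}$ nonzero, finitely supported, $\operatorname{supp}g_1<\dots<\operatorname{supp}g_k$; (ii) $\operatorname{supp}g_i\in\mathcal S_{n_{j_i}}$, $n_{j_1}=n_1$, $n_{j_1}<\dots<n_{j_k}$; (iii) $m_{j_1}=m_1$ and $m_{j_i}=\sigma((g_1,m_{j_1}),\dots,(g_{i-1},m_{j_{i-1}}))$ for $2\le i\le k$; (iv) $\{\min\operatorname{supp}g_i:1\le i\le k\}\in\mathcal S_\xi$. It is ordered by initial segments. Each $\tilde t\in\widetilde{\mathcal T}_\xi$ is determined by its last entry $t=(g_t,m_{j_t})$; let $\mathcal T_\xi=\{t:\tilde t\in\widetilde{\mathcal T}_\xi\}$ with the induced order $\le_{\mathcal T_\xi}$, and $\mathcal W_\xi=\{m_{j_t}:\tilde t\in\widetilde{\mathcal T}_\xi\}$ with order: $m_{j_{t_1}}\le_{\mathcal W_\xi}m_{j_{t_2}}$ if the sequence of weights ending in $m_{j_{t_1}}$ is an initial segment of the sequence of weights ending in $m_{j_{t_2}}$ (each $m_{j_t}$ determines the whole sequence of weights of $\tilde t$). A set $X\subset\mathcal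 T_\xi$ is essentially incomparable if whenever $(g_{t_1},m_{j_{t_1}}),(g_{t_2},m_{j_{t_2}})\in X$ with $m_{j_{t_1}}<_{\mathcal W_\xi}m_{j_{t_2}}$ and $g$ is the unique function with $(g,m_{j_{t_1}})\le_{\mathcal T_\xi}(g_{t_2},m_{j_{t_2}})$, then $\operatorname{supp}g<\operatorname{supp}g_{t_1}$. Norming set: $G_0=\{\pm e_n^*:n\in\mathbb{N}\}$, $G_1=\{m_j^{-1}\sum_n g(n)e_n^*: j\in\mathbb{N},\ g:\mathbb{N}\to\{-1,0,1\},\ \operatorname{supp}g\in\mathcal S_{n_j}\}$, $G=G_0\cup G_1$. $W_G\subset c_{00}(\mathbb{N})$ is the smallest set containing $G$ such that $\frac12\sum_{i=1}^nf_i\in W_G$ whenever $f_1,\dots,f_n\in W_G$ are nonzero with $n\le\operatorname{supp}f_1<\dots<\operatorname{supp}f_n$. A tree analysis of $f\in W_G$ is a family $(f_\alpha)_{\alpha\in\mathcal A}\subset W_G$ indexed by a finite tree $\mathcal A$ with unique root $0$, $f_0=f$, $f_\alpha\in G$ for maximal $\alpha$, and for non-maximal $\alpha$ with immediate successors $s_1,\dots,s_d$ (suitably enumerated) $f_\alpha=\frac12\sum_{i=1}^df_{s_i}$ with $f_{s_i}$ nonzero and $d\le\operatorname{supp}f_{s_1}<\dots<\operatorname{supp}f_{s_d}$. Let $\mathcal M^1_f$ be the set of maximal $\alpha\in\mathcal A$ with $f_\alpha\in G_1$, and for $f_\alpha=m_j^{-1}\sum_ng(n)e_n^*\in G_1$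 put $t_{f_\alpha}=(g,m_j)$. $W$ is the set of $f\in W_G$ having a tree analysis for which $\{t_{f_\alpha}:\alpha\in\mathcal M^1_f\}$ is an essentially incomparable subset of $\mathcal T_\xi$. $T^\xi_{ess\text{-}inc}$ is the completion of $c_{00}(\mathbb{N})$ under $\|x\|_W=\sup\{f(x):f\in W\}$; the unit vectors $(e_j)_j$ form a 1-unconditional basis. $c_0$-tree: a $c_0$-tree of height $\omega^\xi$ supported by $(e_j)_{j\in M}$ is a set of nonempty finite block sequences $(x_1,\dots,x_k)$ of finitely supported vectors with supports contained in $M$, closed under nonempty initial segments, which, ordered by initial segments, is a well-founded tree of height $\omega^\xi$ in which every non-maximal node has infinitely many immediate successors, and such that for some constant $C$ every node $(x_1,\dots,x_k)$ satisfies $C^{-1}\max_i|a_i|\le\|\sum_{i=1}^ka_ix_i\|\le C\max_i|a_i|$ for all scalars. The height of a well-founded tree is the least ordinal at which iteratively removing maximal nodes (taking intersections at limits) yields the empty set. Asymptotic $\ell_1$: a Banach space $Z$ is Asymptotic $\ell_1$ if there is a constant $C$ such that for every $n$, in the $n$-turn game where in turn $k$ player (S) picks a finite codimensional subspace $Y_k$ of $Z$ and then player (V) picks a normalized $x_k\in Y_k$, player (S) has a strategy forcing $(x_k)_{k=1}^n$ to be $C$-equivalent to the unit vector basis of $\ell_1^n$.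
   Formalization: The assertion that the space generated by $(e_j)_{j\in M}$ is not Asymptotic $\ell_1$ is stated only for $\xi\ge 1$; for $\xi=0$ all weights equal $m_1$ and that space is Asymptotic $\ell_1$, so the claim fails there. *)

(* Defs.v *)
From HB Require Import structures.
From mathcomp Require Import all_boot all_order all_algebra.
From mathcomp Require Import all_classical all_reals all_analysis.
Import Order.TTheory GRing.Theory Num.Theory numFieldNormedType.Exports.

Set Implicit Arguments.
Unset Strict Implicit.
Unset Printing Implicit Defensive.

Local Open Scope classical_set_scope.
Local Open Scope ring_scope.

(* Brouwer trees denote countable ordinals: CL f denotes the supremum of the
   f n, for an arbitrary sequence f.  Every countable ordinal is denoted, in
   general by many trees, so equality of ordinals is ceq and not =. *)
Inductive cord : Type :=
| CZ : cord
| CS : cord -> cord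
| CL : (nat -> cord) -> cord.

(* a + 1 <= b holds iff a < b, that is, b = b' + 1 with a <= b', or b is the
   supremum of the g n and a < g n for some n. *)
Fixpoint cle (a b : cord) {struct a} : Prop :=
  match a with
  | CZ => True
  | CS a' => (fix above (b : cord) : Prop :=
               match b with
               | CZ => False
               | CS b' => cle a' b'
               | CL g => exists n, above (g n)
               end) b
  | CL f => forall n, cle (f n) b
  end.

Definition clt (a b : cord) : Prop := cle (CS a) b.
Definition ceq (a b : cord) : Prop := cle a b /\ cle b a.

Definition climit (a : cord) : Prop :=
  clt CZ a /\ forall b, clt b a -> clt (CS b) a.

Definition cnat (n : nat) : cord := iter n CS CZ.

Fixpoint cadd (a b : cord) : cord :=
  match b with
  | CZ => a
  | CS b' => CS (cadd a b')
  | CL f => CL (fun n => cadd a (f n))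
  end.

(* omega ^ (a + 1) = omega ^ a * omega = sup_n (omega ^ a * n) *)
Fixpoint omega_pow (a : cord) : cord :=
  match a with
  | CZ => CS CZ
  | CS a' => CL (fun n => iter n (fun b => cadd b (omega_pow a')) CZ)
  | CL f => CL (fun n => omega_pow (f n))
  end.

Definition posnat : Type := {n : nat | (0 < n)%N}.

Definition pval (p : posnat) : nat := val p.
Coercion pval : posnat >-> nat.

(* For finite sets, E < F and n <= E, with the convention that these hold when
   one of the sets involved is empty. *)
Definition set_lt (E F : set posnat) : Prop :=
  forall p q, E p -> F q -> (p < q)%N.
Definition le_set (n : nat) (E : set posnat) : Prop :=
  forall p, E p -> (n <= p)%N.

Definition is_min (E : set posnat) (p : posnat) : Prop :=
  E p /\ forall q, E q -> (p <= q)%N.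

Definition supp (V : nmodType) (f : posnat -> V) : set posnat :=
  [set p | f p != 0].

(* lad a is the sequence chosen at the limit ordinal a; it depends only on the
   ordinal denoted by a. *)
Record is_ladder (lad : cord -> posnat -> cord) : Prop := IsLadder {
  ladder_ceq : forall a b, climit a -> ceq a b ->
    forall j, ceq (lad a j) (lad b j);
  ladder_ge1 : forall a, climit a -> forall j, cle (cnat 1) (lad a j);
  ladder_lt : forall a, climit a -> forall j, clt (lad a j) a;
  ladder_incr : forall a, climit a ->
    forall i j : posnat, (i < j)%N -> clt (lad a i) (lad a j);
  ladder_cofinal : forall a, climit a ->
    forall b, clt b a -> exists j, clt b (lad a j)
}.

Inductive schreier (lad : cord -> posnat -> cord) :
    cord -> set posnat -> Prop :=
| schreier_set0 a : ceq a CZ -> schreier lad a set0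
| schreier_set1 a p : ceq a CZ -> schreier lad a [set p]
| schreier_succ0 a b : ceq a (CS b) -> schreier lad a set0
| schreier_succ a b (n : nat) (E : nat -> set posnat) :
    ceq a (CS b) -> (0 < n)%N ->
    (forall i, (i < n)%N -> schreier lad b (E i)) ->
    (forall i, (i < n)%N -> E i !=set0) ->
    (forall i j, (i < j < n)%N -> set_lt (E i) (E j)) ->
    le_set n (E 0%N) ->
    schreier lad a (\bigcup_(i in [set i | (i < n)%N]) E i)
| schreier_limit a (j : posnat) E :
    climit a -> schreier lad (lad a j) E -> le_set j E -> schreier lad a E.

Record is_weights (R : realType) (m n : nat -> nat) : Prop := IsWeights {
  weights_m_incr : forall i j, (i < j)%N -> (m i < m j)%N;
  weights_n_incr : forall i j, (i < j)%N -> (n i < n j)%N;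
  weights_m0 : m 0%N = 2%N;
  weights_m1 : m 1%N = 4%N;
  weights_m : forall j, (2 <= j)%N -> (m j.-1 ^ 2 <= m j)%N;
  weights_n0 : n 0%N = 1%N;
  weights_n1 : n 1%N = 6%N;
  weights_n : forall j, (2 <= j)%N ->
    (ln ((m j)%:R ^+ 2) / ln 2 + (n j.-1)%:R < (n j)%:R :> R)
}.

(* A pair (g, m_j); the second component is the weight m_j and not j. *)
Notation wfun := ((posnat -> int) * nat)%type.

Definition sign_valued (g : posnat -> int) : Prop :=
  forall p, g p \in [:: -1; 0; 1].

Definition wfun0 : wfun := (fun=> 0, 0%N).
Definition entry (s : seq wfun) (i : nat) : wfun := nth wfun0 s i.
Definition weight_seq (s : seq wfun) : seq nat := map snd s.

Definition special_seq (m : nat -> nat) : set (seq wfun) :=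
  [set s | [/\ s <> [::],
    forall i, (i < size s)%N ->
      [/\ sign_valued (entry s i).1, finite_set (supp (entry s i).1) &
          exists2 j, (0 < j)%N & (entry s i).2 = m j] &
    forall i i', (i < i' < size s)%N ->
      ((entry s i).2 < (entry s i').2)%N]].

(* sigma is only constrained on special_seq m *)
Record is_coding (m : nat -> nat) (sigma : seq wfun -> nat) : Prop := IsCoding {
  coding_range : forall s, special_seq m s ->
    exists2 j, (0 < j)%N & sigma s = m j;
  coding_inj : forall s t, special_seq m s -> special_seq m t ->
    sigma s = sigma t -> s = t;
  coding_gt : forall s, special_seq m s -> ((last wfun0 s).2 < sigma s)%N
}.

Section EssInc.
Context (R : realType) (lad : cord -> posnat -> cord) (m n : nat -> nat)
  (sigma : seq wfun -> nat) (xi : cord).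

(* js i is the index of the weight of the i-th entry; entries are numbered
   from 0. *)
Definition Ttilde : set (seq wfun) :=
  [set s | s <> [::] /\ exists js : nat -> nat,
    [/\ (forall i, (i < size s)%N ->
           (0 < js i)%N /\ (entry s i).2 = m (js i)),
        [/\ (forall i, (i < size s)%N ->
               [/\ sign_valued (entry s i).1, finite_set (supp (entry s i).1) &
                   supp (entry s i).1 !=set0]) &
            (forall i i', (i < i' < size s)%N ->
               set_lt (supp (entry s i).1) (supp (entry s i').1))],
        [/\ (forall i, (i < size s)%N ->
               schreier lad (cnat (n (js i))) (supp (entry s i).1)),
            n (js 0%N) = n 1%N &
            (forall i i', (i < i' < size s)%N -> (n (js i) < n (js i'))%N)],
        [/\ (entry s 0).2 = m 1%N &
            (forall i, (0 < i < size s)%N ->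
               (entry s i).2 = sigma (take i s))] &
        schreier lad xi
          [set p | exists2 i, (i < size s)%N &
                     is_min (supp (entry s i).1) p]]].

Definition Ttree : set wfun :=
  [set t | exists2 s, Ttilde s & last wfun0 s = t].

Definition Ttree_le (t1 t2 : wfun) : Prop :=
  exists s1 u, [/\ Ttilde s1, Ttilde (s1 ++ u),
    last wfun0 s1 = t1 & last wfun0 (s1 ++ u) = t2].

Definition Wtree_le (w1 w2 : nat) : Prop :=
  exists s1 s2, [/\ Ttilde s1, Ttilde s2,
    (last wfun0 s1).2 = w1, (last wfun0 s2).2 = w2 &
    prefix (weight_seq s1) (weight_seq s2)].

Definition Wtree_lt (w1 w2 : nat) : Prop := Wtree_le w1 w2 /\ w1 <> w2.

Definition ess_incomparable (X : set wfun) : Prop :=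
  X `<=` Ttree /\
  forall t1 t2, X t1 -> X t2 -> Wtree_lt t1.2 t2.2 ->
    forall g, Ttree_le (g, t1.2) t2 -> set_lt (supp g) (supp t1.1).

(* The functional sum_p f(p) e_p^* is represented by its coefficients f. *)

Definition unit_vec (p : posnat) : posnat -> R := fun q => (q == p)%:R.

Definition G0 : set (posnat -> R) :=
  [set f | exists p, f = unit_vec p \/ f = - unit_vec p].

(* (g, m_j) is a pair t_f of the functional f = m_j^-1 sum_p g(p) e_p^* of G1;
   it is unique unless f = 0. *)
Definition G1_pair (f : posnat -> R) (t : wfun) : Prop :=
  [/\ sign_valued t.1,
      f = (fun p => (t.2)%:R^-1 * (t.1 p)%:~R) &
      exists j, [/\ (0 < j)%N, t.2 = m j &
                    schreier lad (cnat (n j)) (supp t.1)]].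

Definition G1 : set (posnat -> R) := [set f | exists t, G1_pair f t].

Definition G : set (posnat -> R) := G0 `|` G1.

(* f = (1/2) sum_(i < d) F i, with F i nonzero, d <= supp F 0 < supp F 1 < ... *)
Definition admissible_half (d : nat) (F : nat -> posnat -> R)
    (f : posnat -> R) : Prop :=
  [/\ (0 < d)%N,
      forall i, (i < d)%N -> F i <> 0,
      forall i i', (i < i' < d)%N -> set_lt (supp (F i)) (supp (F i')),
      le_set d (supp (F 0%N)) &
      f = 2^-1 *: (\sum_(i < d) F i)].

Inductive WG : (posnat -> R) -> Prop :=
| WG_G f : G f -> WG f
| WG_half d F f : (forall i, (i < d)%N -> WG (F i)) ->
    admissible_half d F f -> WG f.

(* The nodes of the finite tree A are addresses: the root is [::] and the
   immediate successors of s are the rcons s i in A, i < d. *)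
Definition maximal_node (A : set (seq nat)) (s : seq nat) : Prop :=
  A s /\ forall i, ~ A (rcons s i).

Record tree_analysis (f : posnat -> R) (A : set (seq nat))
    (F : seq nat -> posnat -> R) : Prop := TreeAnalysis {
  analysis_finite : finite_set A;
  analysis_root : A [::] /\ F [::] = f;
  analysis_closed : forall s i, A (rcons s i) -> A s;
  analysis_WG : forall s, A s -> WG (F s);
  analysis_max : forall s, maximal_node A s -> G (F s);
  analysis_half : forall s, A s -> ~ maximal_node A s ->
    exists d, (forall i, A (rcons s i) <-> (i < d)%N) /\
      admissible_half d (fun i => F (rcons s i)) (F s)
}.

Definition W : set (posnat -> R) :=
  [set f | WG f /\ exists A F, tree_analysis f A F /\
    ess_incomparable
      [set t | exists2 s, maximal_node A s & G1_pair (F s) t]].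

Definition c00 : set (posnat -> R) := [set x | finite_set (supp x)].

Definition pairing (f x : posnat -> R) : R :=
  \sum_(p \in supp x) f p * x p.

Definition normW (x : posnat -> R) : R :=
  sup [set r | exists2 f, W f & r = pairing f x].

End EssInc.

Section Banach.
Context (R : realType) (V : completeNormedModType R).

Definition lincomb (e : posnat -> V) (x : posnat -> R) : V :=
  \sum_(p \in supp x) x p *: e p.

(* V is the completion of (c00, nrm), the unit vectors being sent to the e p. *)
Record is_completion (nrm : (posnat -> R) -> R) (e : posnat -> V) : Prop :=
  IsCompletion {
    completion_norm : forall x, @c00 R x -> `|lincomb e x| = nrm x;
    completion_dense : closure [set lincomb e x | x in @c00 R] = setT
  }.

Definition closed_span (e : posnat -> V) (M : set posnat) : set V :=
  closure [set lincomb e x | x in [set x | @c00 R x /\ supp x `<=` M]].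

(* Subspaces of a Banach space are closed. *)
Definition closed_subspace (Y : set V) : Prop :=
  [/\ closed Y, Y 0 & forall (a : R) u v, Y u -> Y v -> Y (a *: u + v)].

Definition finite_codim_subspace (Z Y : set V) : Prop :=
  [/\ closed_subspace Y, Y `<=` Z &
      exists d (v : 'I_d -> V), (forall i, Z (v i)) /\
        forall z, Z z -> exists y (a : 'I_d -> R),
          Y y /\ z = y + \sum_(i < d) a i *: v i].

Definition equiv_l1 (C : R) (k : nat) (x : nat -> V) : Prop :=
  forall a : nat -> R,
    C^-1 * (\sum_(i < k) `|a i|) <= `|\sum_(i < k) a i *: x i|
      <= C * (\sum_(i < k) `|a i|).

(* Z is a closed subspace of V, regarded as a Banach space.  A strategy of
   player (S) maps the list of the vectors played so far by (V) to the next
   subspace. *)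
Definition asymptotic_l1 (Z : set V) : Prop :=
  exists C : R, 0 < C /\ forall k : nat, exists S : seq V -> set V,
    (forall h, finite_codim_subspace Z (S h)) /\
    forall x : nat -> V,
      (forall i, (i < k)%N -> S (mkseq x i) (x i) /\ `|x i| = 1) ->
      equiv_l1 C k x.

End Banach.

Section Trees.
Context (A : Type).

(* the order by proper initial segments *)
Definition initial_lt (s t : seq A) : Prop :=
  exists u, u <> [::] /\ t = s ++ u.

Definition derived (T : set (seq A)) : set (seq A) :=
  [set s | T s /\ exists2 t, T t & initial_lt s t].

(* As the derived trees decrease, the intersection over a sequence is the
   right value at its supremum whether or not the supremum is attained. *)
Fixpoint derived_iter (T : set (seq A)) (a : cord) : set (seq A) :=
  match a with
  | CZ => T
  | CS b => derived (derived_iter T b)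
  | CL f => \bigcap_k derived_iter T (f k)
  end.

Definition well_founded_tree (T : set (seq A)) : Prop :=
  well_founded (fun t s => [/\ T s, T t & initial_lt s t]).

Definition has_height (T : set (seq A)) (a : cord) : Prop :=
  derived_iter T a = set0 /\ forall b, clt b a -> derived_iter T b <> set0.

End Trees.

Definition equiv_c0 (R : realType) (V : completeNormedModType R) (C : R)
    (k : nat) (x : nat -> V) : Prop :=
  forall a : nat -> R,
    C^-1 * (\big[Num.max/0]_(i < k) `|a i|) <= `|\sum_(i < k) a i *: x i|
      <= C * (\big[Num.max/0]_(i < k) `|a i|).

Record c0_tree (R : realType) (V : completeNormedModType R) (e : posnat -> V)
    (M : set posnat) (a : cord) (T : set (seq (posnat -> R))) : Prop :=
  C0Tree {
    c0_tree_nonempty : forall s, T s -> s <> [::];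
    c0_tree_c00 : forall s i, T s -> (i < size s)%N -> @c00 R s`_i;
    c0_tree_supp : forall s i, T s -> (i < size s)%N -> supp s`_i `<=` M;
    c0_tree_block : forall s i j, T s -> (i < j < size s)%N ->
      set_lt (supp s`_i) (supp s`_j);
    c0_tree_closed : forall s u, s <> [::] -> T (s ++ u) -> T s;
    c0_tree_wf : well_founded_tree T;
    c0_tree_height : has_height T a;
    c0_tree_branching : forall s, derived T s ->
      infinite_set [set x | T (rcons s x)];
    c0_tree_equiv : exists C : R, 0 < C /\
      forall s, T s -> equiv_c0 C (size s) (fun i => lincomb e s`_i)
  }.

(* Main.v *)
(* Along a branch of the tree, the i-th vector is m_j times an average of unit
   vectors whose support F_i lies in S_{n_j} but which is small on S_{n_j - 1},
   where m_j is the weight that sigma assigns to the pairs (chi F_1, m_{j_1}),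
   ..., (chi F_{i-1}, m_{j_{i-1}}).  A functional of W acts on such a vector
   essentially only through its leaves of weight m_j.  If leaves of two of the
   weights of the branch occur, then, sigma being injective, essential
   incomparability forces the leaves with the smaller weight to live beyond
   the corresponding F_i; so only the largest weight that occurs contributes,
   and the branch is equivalent to the basis of c_0.  The rank of the tree is
   controlled by labelling its nodes with ordinals: the minimum of the last
   support encodes which predecessor of the previous label is taken.

   In the game, bounded sequences have differences arbitrarily close to any
   subspace of finite codimension, so (V) can play almost multiples of
   differences v_p - v_p' of such vectors, only the support of v_p' being
   recorded in the branch. *)

Require Import Defs.
From mathcomp Require Import all_boot all_order all_algebra.
From mathcomp Require Import all_classical all_reals all_analysis.
From mathcomp Require Import ring lra.
Import Order.TTheory GRing.Theory Num.Theory numFieldNormedType.Exports.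

Set Implicit Arguments.
Unset Strict Implicit.
Unset Printing Implicit Defensive.

Local Open Scope classical_set_scope.

(* mathcomp-analysis has another cadd, for charges. *)
Local Notation cadd := Defs.cadd.

(** * Countable ordinals *)

(** The growth of the parameters comes from the estimate for one vector. Let a functional of W act
    on m_j times an average c. Unit leaves and leaves of weight below m_j that are halved at most
    log_2 m_j^2 times live on a set of Schreier order n_{j-1} + log_2 m_j^2 < n_j, because each
    halving raises the order by one; there c is so small that the factor m_j does no harm. The other
    coefficients, except at leaves of weight m_j, are at most m_j^-2, by the halvings or by m_{j+1}
    >= m_j^2. So the errors are of order 1 / m_j and summable along a branch, and only leaves of
    weight m_j itself can contribute a constant.

    In the game, a subspace chosen by (S) need not contain any vector of the tree, and a difference
    is not supported on a single F_i. But the argument from essential incomparability only uses that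
    the vector does not reach beyond max F_i. Hence recording the support of the later half is
    enough, and the leaf on that half also shows that the difference has norm at least 1. *)

Lemma cleSS (a b : cord) : cle (CS a) (CS b) = cle a b.
Proof. by []. Qed.

Lemma cle_CLr (a : cord) (g : nat -> cord) k : cle a (g k) -> cle a (CL g).
Proof.
by elim: a => [//|a IH|f IH] h; [exists k | move=> i; apply: IH; exact: h].
Qed.

Lemma cle_refl (a : cord) : cle a a.
Proof. by elim: a => [//|//|f IH] k; exact: cle_CLr (IH k). Qed.

Lemma cle_trans (b a c : cord) : cle a b -> cle b c -> cle a c.
Proof.
elim: a b c => [//|a IHa|f IHf] b c; last first.
  by move=> h bc k; exact: IHf (h k) bc.
elim: b c => [//|b IHb|g IHg] c.
- move=> ab; elim: c => [//|c IHc|h IHh]; first exact: IHa ab.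
  by case=> k hk; exists k; exact: IHh hk.
- by case=> k hk bc; exact: IHg hk (bc k).
Qed.

Lemma cle_succ (a : cord) : cle a (CS a).
Proof.
elim: a => [//|//|f IH] k; apply: cle_trans (IH k) _.
rewrite cleSS; exact: cle_CLr (cle_refl _).
Qed.

Lemma clt_le (a b : cord) : clt a b -> cle a b.
Proof. by move=> h; exact: cle_trans (cle_succ a) h. Qed.

Lemma cle_lt_trans (b a c : cord) : cle a b -> clt b c -> clt a c.
Proof. by move=> ab; apply: cle_trans. Qed.

Lemma clt_le_trans (b a c : cord) : clt a b -> cle b c -> clt a c.
Proof. exact: cle_trans. Qed.

Lemma cle_total (a b : cord) : cle a b \/ clt b a.
Proof.
elim: a b => [|a IHa|f IHf] b; first by left.
- elim: b => [|b _|g IHg]; first by right.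
  + exact: IHa.
  + have [[k hk]|h] := pselect (exists k, cle (CS a) (g k)).
      by left; exists k.
    right=> k; case: (IHg k) => // hk; exfalso; apply: h; by exists k.
- have [h|/existsNP[k hk]] := pselect (forall k, cle (f k) b); first by left.
  by right; exists k; case: (IHf k b).
Qed.

(** Predecessors of [CL g] need not be subtrees, but each lies below some [g k]; so accessibility is
    shown for every [a] below [b], by induction on the tree [b]. *)
Lemma clt_wf : well_founded clt.
Proof.
suff h b a : cle a b -> Acc clt a by move=> a; exact: h (cle_refl a).
elim: b a => [|b IH|g IH] a ab; constructor=> c ca.
- by have := clt_le_trans ca ab.
- by apply: IH; exact: clt_le_trans ca ab.
- by have [k hk] := clt_le_trans ca ab; apply: IH (clt_le hk).
Qed.

Lemma clt_irrefl (a : cord) : ~ clt a a.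
Proof. by elim/(well_founded_ind clt_wf): a => a IH h; exact: (IH _ h h). Qed.

Lemma cord_cases (a : cord) :
  [\/ ceq a CZ, exists b, ceq a (CS b) | climit a].
Proof.
have [a0|a0] := cle_total a CZ; first by constructor 1.
have [h|/existsNP[b /not_implyP[ba nb]]] :=
  pselect (forall b, clt b a -> clt (CS b) a); first by constructor 3.
by constructor 2; exists b; split=> //; case: (cle_total a (CS b)).
Qed.

Lemma cadd_lel (a b : cord) : cle a (cadd a b).
Proof.
elim: b => [|b IH|f IH] /=; first exact: cle_refl.
  exact: cle_trans IH (cle_succ _).
exact: cle_CLr (IH 0%N).
Qed.

Lemma cadd_mono (a a' b b' : cord) :
  cle a a' -> cle b b' -> cle (cadd a b) (cadd a' b').
Proof.
move=> aa; elim: b b' => [|b IHb|f IHf] b'.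
- by move=> _; exact: cle_trans aa (cadd_lel _ _).
- elim: b' => [//|b' _|g IHg]; first exact: IHb.
  by case=> k hk; exists k; exact: IHg.
- by move=> h k; exact: IHf.
Qed.

Lemma cadd0l (b : cord) : cle b (cadd CZ b).
Proof. by elim: b => [//|//|f IH] k /=; exact: cle_CLr (IH k). Qed.

Lemma omega_pow_gt0 (a : cord) : cle (CS CZ) (omega_pow a).
Proof.
elim: a => [//|a IH|f IH]; last by exists 0%N; exact: IH.
by exists 1%N => /=; exact: cle_trans IH (cadd0l _).
Qed.

Lemma omega_pow_mono (a b : cord) : cle a b -> cle (omega_pow a) (omega_pow b).
Proof.
elim: a b => [|a IHa|f IHf] b; first by move=> _; exact: omega_pow_gt0.
- elim: b => [//|b _|g IHg].
  + move=> ab k /=; apply: (@cle_CLr _ _ k).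
    elim: k => [//|k IHk]; rewrite !iterS; exact: cadd_mono IHk (IHa _ ab).
  + by case=> k hk; exact: cle_CLr (IHg k hk).
- by move=> h k; exact: IHf.
Qed.

Lemma omega_pow1 k : cle (cnat k) (omega_pow (CS CZ)).
Proof.
apply: (@cle_CLr _ _ k); elim: k => [//|k IH].
exact: cle_trans IH (cle_refl _).
Qed.

Lemma climit_nsucc (a b : cord) : climit a -> ~ ceq a (CS b).
Proof.
move=> [_ al] [ab ba]; have h := clt_le_trans (al _ ba) ab.
exact: clt_irrefl h.
Qed.

Lemma ceqZ_nsucc (a b : cord) : ceq a CZ -> ~ ceq a (CS b).
Proof. by move=> [a0 _] [_ ba]; have := cle_trans ba a0. Qed.

Lemma ceq_refl (a : cord) : ceq a a.
Proof. by split; exact: cle_refl. Qed.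

(** * Schreier families *)

Definition pos (i : nat) : posnat := exist (fun k => (0 < k)%N) i.+1 isT.

Lemma pos_predK (p : posnat) : pos (pval p).-1 = p.
Proof. by apply: val_inj; rewrite /= prednK //; case: p. Qed.

Lemma pos_inj : injective pos.
Proof. by move=> i j /(congr1 pval)[]. Qed.

Lemma posnat_gt0 (p : posnat) : (0 < p)%N.
Proof. by case: p. Qed.

Definition pbounded (D : set posnat) : Prop :=
  exists B : nat, forall p, D p -> (p < B)%N.

Section Schreier.
Context (lad : cord -> posnat -> cord).
Local Notation S := (schreier lad).

Lemma bigcup_lt0 (E : nat -> set posnat) :
  \bigcup_(i in [set i | (i < 0)%N]) E i = set0.
Proof. by rewrite seteqP; split=> p // [i]. Qed.

Lemma bigcup_ltS (E : nat -> set posnat) k :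
  \bigcup_(i in [set i | (i < k.+1)%N]) E i =
  \bigcup_(i in [set i | (i < k)%N]) E i `|` E k.
Proof.
rewrite seteqP; split=> p.
  move=> [i /=]; rewrite ltnS leq_eqVlt => /orP[/eqP->|ik] Ep; first by right.
  by left; exists i.
by case=> [[i /= ik Ep]|Ep]; [exists i => //=; exact: ltnW | exists k => /=].
Qed.

(* D is the union of k successive, possibly empty, members of S_b. *)
Inductive chain (b : cord) : nat -> set posnat -> Prop :=
| chain0 : chain b 0 set0
| chainS k D E : chain b k D -> S b E -> set_lt D E -> chain b k.+1 (D `|` E).

Lemma chain_bigcup b k (E : nat -> set posnat) :
  (forall i, (i < k)%N -> S b (E i)) ->
  (forall i j, (i < j < k)%N -> set_lt (E i) (E j)) ->
  chain b k (\bigcup_(i in [set i | (i < k)%N]) E i).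
Proof.
elim: k => [|k IH] hS hlt; first by rewrite bigcup_lt0; exact: chain0.
rewrite bigcup_ltS; apply: chainS; last 1 first.
- by move=> p q [i /= ik Ep]; apply: (hlt i k) => //; rewrite ik ltnSn.
- by apply: IH => [i ik|i j /andP[ij jk]];
    [apply: hS; exact: ltnW | apply: hlt; rewrite ij ltnW].
- by apply: hS.
Qed.

(** [schreier_succ] asks for nonempty pieces. Discarding the empty ones only lowers their number, so
    a bound of that number by the minimum survives. *)
Lemma chain_nonempty b k D : chain b k D ->
  exists (k' : nat) (E : nat -> set posnat), [/\ (k' <= k)%N,
    forall i, (i < k')%N -> S b (E i),
    forall i, (i < k')%N -> E i !=set0,
    forall i j, (i < j < k')%N -> set_lt (E i) (E j) &
    D = \bigcup_(i in [set i | (i < k')%N]) E i].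
Proof.
elim=> [|{}k {}D E _ [k' [F [kk FS F0 Flt ->]]] SE DE].
  by exists 0%N, (fun=> set0); split=> //; rewrite ?bigcup_lt0 // => i j;
    rewrite andbF.
have [->|E0] := eqVneq E set0.
  by exists k', F; rewrite setU0; split=> //; exact: leqW.
exists k'.+1, (fun i => if (i < k')%N then F i else E).
have eF : \bigcup_(i in [set i | (i < k')%N]) (if (i < k')%N then F i else E) =
    \bigcup_(i in [set i | (i < k')%N]) F i.
  by apply: eq_bigcupr => i /= ->.
split=> //.
- by move=> i; case: ifP => [/FS //|].
- by move=> i; case: ifP => [/F0 //|_ _]; exact/set0P.
- move=> i j /andP[ij]; rewrite ltnS => jk; rewrite (leq_trans ij jk).
  case: ifP => [jk'|_]; first by apply: Flt; rewrite ij.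
  by move=> p q Fp Eq; apply: DE => //; exists i => //=; exact: leq_trans ij jk.
- by rewrite bigcup_ltS eF ltnn.
Qed.

Lemma schreier_chain a b k D : ceq a (CS b) -> chain b k D -> le_set k D ->
  S a D.
Proof.
move=> ab /chain_nonempty[k' [E [kk ES E0 Elt ->]]] kD.
case: k' => [|k'] in kk ES E0 Elt kD *.
  by rewrite bigcup_lt0; exact: schreier_succ0 ab.
apply: schreier_succ ab _ ES E0 Elt _ => // p Ep.
by apply: leq_trans kk _; apply: kD; exists 0%N.
Qed.

Lemma chain1 b E : S b E -> chain b 1 E.
Proof. by move=> SE; rewrite -(set0U E); apply: chainS => //;
  exact: chain0. Qed.

Lemma schreier_succ_le (b : cord) E : S b E -> S (CS b) E.
Proof.
move=> SE; apply: (schreier_chain (ceq_refl _) (chain1 SE)) => p _.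
exact: posnat_gt0.
Qed.

Lemma schreier_cnat_le (i j : nat) E : (i <= j)%N -> S (cnat i) E ->
  S (cnat j) E.
Proof.
move=> /subnKC<-; elim: (j - i)%N => [|k IH] SE; first by rewrite addn0.
rewrite addnS; exact: schreier_succ_le (IH SE).
Qed.

Lemma schreier_ceq (hlad : is_ladder lad) a b E : ceq a b -> S a E -> S b E.
Proof.
move=> + SE; have ceqt c c' c'' : ceq c c' -> ceq c c'' -> ceq c' c''.
  move=> [h1 h2] [h3 h4].
  by split; [exact: cle_trans h2 h3 | exact: cle_trans h4 h1].
have ceqs c c' : ceq c c' -> ceq c' c by case.
elim: SE b => {a E}.
- by move=> a a0 b ab; apply: schreier_set0; exact: ceqt ab a0.
- by move=> a p a0 b ab; apply: schreier_set1; exact: ceqt ab a0.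
- by move=> a c ac b ab; apply: schreier_succ0; exact: ceqt ab ac.
- by move=> a c k E ac k0 ES _ E0 Elt lE b ab;
  exact: (schreier_succ (ceqt _ _ _ ab ac) k0 ES E0 Elt lE).
- move=> a j E al SE IH jE b ab; apply: (@schreier_limit _ _ j) => //.
    case: al => a0 al; split; first exact: clt_le_trans a0 (proj1 ab).
    by move=> c cb; apply: clt_le_trans (proj1 ab); apply: al;
      apply: clt_le_trans cb (proj2 ab).
  by apply: IH; exact: ladder_ceq.
Qed.

Lemma schreierZ E : S CZ E -> E = set0 \/ exists p, E = [set p].
Proof.
move=> SE; inversion SE as [|a p|a b ab|a b k F ab|a j F al]; subst.
- by left.
- by right; exists p.
- by left.
- by exfalso; exact: ceqZ_nsucc (ceq_refl _) ab.
- by exfalso; case: al.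
Qed.

Lemma schreierSP (hlad : is_ladder lad) b E : S (CS b) E ->
  E = set0 \/ exists (k : nat) (F : nat -> set posnat), [/\
    forall i, (i < k)%N -> S b (F i), le_set k E &
    E = \bigcup_(i in [set i | (i < k)%N]) F i].
Proof.
move=> SE; inversion SE as [a h|a p h|a c ac|a c k F ac k0 FS F0 Flt lF|a j F
  al]; subst.
- by exfalso; exact: ceqZ_nsucc h (ceq_refl _).
- by exfalso; exact: ceqZ_nsucc h (ceq_refl _).
- by left.
- right; exists k, F; split=> //.
  + by move=> i /FS; apply: schreier_ceq => //; case: ac; split.
  + move=> p [[|i] /= ik Fp]; first exact: lF.
    have [q Fq] := F0 0%N k0; apply: leq_trans (lF _ Fq) _; apply: ltnW.
    exact: (Flt 0%N i.+1).
- by exfalso; exact: climit_nsucc al (ceq_refl _).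
Qed.

(* [game F b E]: starting from E one can add b further points, in the sense of
   the ordinal rank, while staying in F, even if an opponent may forbid
   finitely many points at each step. *)
Fixpoint game (F : set (set posnat)) (b : cord) (E : set posnat) : Prop :=
  match b with
  | CZ => F E
  | CS b' => F E /\ exists P : nat, forall p : posnat, (P <= p)%N ->
               game F b' (E `|` [set p])
  | CL f => forall k, game F (f k) E
  end.

Lemma game_in F b E : game F b E -> F E.
Proof. by elim: b => [//|b _ []//|f IH /(_ 0%N)/IH]. Qed.

Lemma game_le F a b E : cle a b -> game F b E -> game F a E.
Proof.
elim: a b E => [|a IHa|f IHf] b E.
- by move=> _ /game_in.
- elim: b E => [//|b _|g IHg] E.
  + by move=> ab [FE [P hP]]; split=> //; exists P => p /hP; exact: IHa.
  + by case=> k hk h; exact: IHg hk (h k).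
- by move=> h g k; exact: IHf (h k) g.
Qed.

(** The recursion of [cadd a b] unwinds [b] first: the game on [F] is played to its end, and the
    game on [H] starts from the set reached there. *)
Lemma game_add F H a b E : (forall D, F D -> game H a D) ->
  game F b E -> game H (cadd a b) E.
Proof.
move=> FH; elim: b E => [|b IH|f IH] E /=; first exact: FH.
  move=> [FE [P hP]]; split; first exact: game_in (FH _ FE).
  by exists P => p /hP; exact: IH.
by move=> h k; exact: IH.
Qed.

Lemma game_map F H D (k : nat) c E :
  (forall E', F E' -> le_set k E' -> H (D `|` E')) ->
  le_set k E -> game F c E -> game H c (D `|` E).
Proof.
move=> FH; elim: c E => [|c IH|f IH] E kE /=; first by move=> FE; exact: FH.
  move=> [FE [P hP]]; split; first exact: FH.
  exists (maxn P k) => p; rewrite geq_max => /andP[Pp kp].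
  rewrite -setUA; apply: IH; last exact: hP.
  by move=> q [/kE //|->].
by move=> h i; exact: IH.
Qed.

(** Each factor [omega_pow b] is spent on one new member of S_b, played beyond the earlier members.
    As all points are at least [N], up to [N] members are allowed; [k] have been used and [i] are
    still to come. *)
Lemma game_schreier_succ b N i k D c : ceq c (CS b) ->
  game (S b) (omega_pow b) set0 -> pbounded D ->
  chain b k D -> (k + i <= N)%N -> le_set N D ->
  game (S c) (iter i (fun x => cadd x (omega_pow b)) CZ) D.
Proof.
move=> cb gb; elim: i k D => [|i IH] k D [B hB] ch kN ND.
  by rewrite addn0 in kN; apply: schreier_chain cb ch _ => p /ND;
    exact: leq_trans.
rewrite iterS -(setU0 D).
apply: (@game_add (fun D' => pbounded D' /\
   chain b k.+1 D' /\ le_set N D')).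
  by move=> D' [bD' [chD' ND']]; apply: (IH k.+1) => //; rewrite addSnnS.
apply: (@game_map (fun E => S b E /\ pbounded E) _ _ (maxn B N)) => //.
  move=> E [SE [B' hB']] le; split.
    exists (maxn B B') => p [/hB|/hB'] h; rewrite leq_max h ?orbT //.
  split; last first.
    by move=> p [/ND //|/le]; rewrite geq_max => /andP[].
  apply: chainS => // p q /hB pB /le; rewrite geq_max => /andP[Bq _].
  exact: leq_trans pB Bq.
(* The game adds one point at a time, so boundedness can be carried along; it lets the next member
   start beyond this one. *)
have aux c' E : pbounded E -> game (S b) c' E ->
   game (fun E => S b E /\ pbounded E) c' E.
  elim: c' E => [//|c' IHc|f IHf] E bE /=.
    move=> [SE [P hP]]; split=> //; exists P => p /hP; apply: IHc.
    case: bE => B' hB'; exists (maxn B' p.+1) => q [/hB' h|->];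
      rewrite leq_max ?h // leqnn orbT //.
  by move=> h j; exact: IHf.
by apply: aux gb; exists 0%N.
Qed.

(** [omega_pow] follows the tree [x] while [schreier] follows the ladder of [x]. Cofinality of the
    ladder compares them, for all [a] below [x] so that the induction can descend into subtrees. *)
Lemma omega_pow_limit (hlad : is_ladder lad) x : climit x ->
  cle (omega_pow x) (CL (fun i => omega_pow (lad x (pos i)))).
Proof.
move=> xl; suff h a : cle a x ->
  cle (omega_pow a) (CL (fun i => omega_pow (lad x (pos i)))).
  exact: h (cle_refl x).
elim: a => [_|a _ ax|f IH fx k].
- exists 0%N; exact: omega_pow_gt0.
- have [j hj] := ladder_cofinal hlad xl (proj2 xl _ ax).
  apply: (@cle_CLr _ _ (pval j).-1); rewrite pos_predK.
  exact: omega_pow_mono (clt_le hj).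
- exact: IH.
Qed.

(** The lower half of the classical fact that the Schreier family of order x has rank omega^x. *)
Lemma game_schreier (hlad : is_ladder lad) x : game (S x) (omega_pow x) set0.
Proof.
elim/(well_founded_ind clt_wf): x => x IH.
case: (cord_cases x) => [x0|[b xb]|xl].
- apply: (@game_le _ _ (CS CZ)); first exact: (omega_pow_mono (proj1 x0)).
  split; first exact: schreier_set0.
  by exists 0%N => p _ /=; rewrite set0U; exact: schreier_set1.
- have gb : game (S b) (omega_pow b) set0 by apply: IH; case: xb.
  apply: (@game_le _ _ _ _ (omega_pow_mono (proj1 xb))) => k.
  apply: (@game_schreier_succ b k k 0 set0) => //; first by exists 0%N.
  exact: chain0.
- apply: game_le (omega_pow_limit hlad xl) _ => k.
  have := IH _ (ladder_lt hlad xl (pos k)).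
  rewrite -{2}(setU0 set0); apply: (@game_map _ _ _ (pos k)) => // E SE lE.
  by rewrite set0U; exact: schreier_limit lE.
Qed.

End Schreier.

Lemma finite_posnat_lt (P : nat) : finite_set [set p : posnat | (p < P)%N].
Proof.
apply: (@sub_finite_set _ _ (pos @` `I_P));
  last exact: finite_image (finite_II P).
move=> p /= pP; exists (pval p).-1; last exact: pos_predK.
by rewrite /= prednK ?posnat_gt0 // ltnW.
Qed.

Lemma pbounded_finite (D : set posnat) : pbounded D -> finite_set D.
Proof. by case=> B hB; apply: sub_finite_set (finite_posnat_lt B) => p /hB. Qed.

Lemma finite_pbounded (D : set posnat) : finite_set D -> pbounded D.
Proof.
move=> /finite_setP[k]; elim: k D => [D|k IH D].
  by rewrite II0 card_eq0 => /eqP->; exists 0%N.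
move=> /eq_cardSP[p Dp /IH[B hB]]; exists (maxn B p.+1) => q Dq.
have [->|qp] := eqVneq q p; first by rewrite leq_max leqnn orbT.
by rewrite leq_max hB //; split=> //=; exact/eqP.
Qed.

Lemma infinite_posnat_ge (M : set posnat) (P : nat) :
  infinite_set M -> exists2 p, M p & (P <= p)%N.
Proof.
move=> Minf; apply: contrapT => h; apply: Minf.
apply: sub_finite_set (finite_posnat_lt P) => p Mp /=.
by rewrite ltnNge; apply/negP => Pp; apply: h; exists p.
Qed.

(** * Averages that are small on lower Schreier families *)

Section Averages.
Context (R : realType) (lad : cord -> posnat -> cord) (hlad : is_ladder lad).
Local Open Scope ring_scope.
Local Notation S := (schreier lad).
Implicit Types (c : posnat -> R) (G : set posnat).

Definition mass (K : nat) G c : R := \sum_(i < K | `[< G (pos i) >]) c (pos i).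

Lemma mass_total K c : mass K setT c = \sum_(i < K) c (pos i).
Proof. by apply: eq_bigl => i; apply/asboolP. Qed.

Lemma mass_mkcond K G c :
  mass K G c = \sum_(i < K) (if `[< G (pos i) >] then c (pos i) else 0).
Proof. by rewrite /mass big_mkcond. Qed.

Lemma mass_setU K G H c : (forall q, 0 <= c q) ->
  mass K (G `|` H) c <= mass K G c + mass K H c.
Proof.
move=> c0; rewrite !mass_mkcond -big_split /=; apply: ler_sum => i _.
case: asboolP => [[h|h]|_]; last by rewrite addr_ge0 //; case: ifP.
  by case: asboolP => // _; rewrite lerDl; case: ifP.
by case: (asboolP (H _)) => // _; rewrite lerDr; case: ifP.
Qed.

Lemma mass_bigcup K k (F : nat -> set posnat) c d : (forall q, 0 <= c q) ->
  (forall i, (i < k)%N -> mass K (F i) c <= d) ->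
  mass K (\bigcup_(i in [set i | (i < k)%N]) F i) c <= d *+ k.
Proof.
move=> c0; elim: k => [|k IH] hF.
  rewrite bigcup_lt0 mulr0n /mass big1 // => i /asboolP [].
rewrite bigcup_ltS mulrSr; apply: le_trans (mass_setU _ _ _ c0) _.
by apply: lerD; [apply: IH => i ik; apply: hF; exact: ltnW | exact: hF].
Qed.

Lemma mass_le K G H c : (forall q, 0 <= c q) -> G `<=` H ->
  mass K G c <= mass K H c.
Proof.
move=> c0 GH; rewrite !mass_mkcond; apply: ler_sum => i _.
by case: asboolP => [/GH h|_]; case: asboolP.
Qed.

Lemma massD K G c c' : mass K G (fun q =>
  c q + c' q) = mass K G c + mass K G c'.
Proof. by rewrite /mass big_split. Qed.

Lemma massZ K G a c : mass K G (fun q => a * c q) = a * mass K G c.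
Proof. by rewrite /mass mulr_sumr. Qed.

(** The total [t] is free so that successive blocks can be added before normalizing. The minimum [p]
    is prescribed because the tree will code ordinal labels by minima. *)
Record block (M : set posnat) (p : posnat) (B : nat) (t : R) c : Prop := Block {
  block_ge0 : forall q, 0 <= c q;
  block_sub : supp c `<=` M;
  block_min : is_min (supp c) p;
  block_bound : forall q : posnat, (B < q)%N -> c q = 0;
  block_total : forall K, (B <= K)%N -> mass K setT c = t
}.

Lemma block_mass_le M p B t c K G : block M p B t c -> mass K G c <= t.
Proof.
move=> bc; have c0 := block_ge0 bc.
apply: le_trans (mass_le _ c0 (@subsetT _ G)) _.
rewrite -(block_total bc (leq_maxl B K)) !mass_total.
rewrite -(@big_mkord _ 0 +%R K xpredT (fun i => c (pos i))).
rewrite -(@big_mkord _ 0 +%R (maxn B K) xpredT (fun i => c (pos i))).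
by rewrite (big_cat_nat _ (leq_maxr B K)) //= lerDl sumr_ge0.
Qed.

Lemma block_supp_le M p B t c q : block M p B t c -> supp c q -> (q <= B)%N.
Proof.
by move=> bc /eqP cq; rewrite leqNgt; apply/negP => /(block_bound bc).
Qed.

Lemma supp_add c c' : (forall q, 0 <= c q) -> (forall q, 0 <= c' q) ->
  supp (fun q => c q + c' q) = supp c `|` supp c'.
Proof.
move=> c0 c'0; rewrite seteqP; split=> q; rewrite /supp /=.
  by have [->|] := eqVneq (c q) 0; rewrite ?add0r; [right | left].
by rewrite paddr_eq0 // negb_and => -[->//|->]; rewrite orbT.
Qed.

Lemma block_add M p B t c (p' : posnat) B' t' c' : (B < p')%N ->
  block M p B t c ->
  block M p' B' t' c' ->
  block M p (maxn B B') (t + t') (fun q => c q + c' q).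
Proof.
move=> Bp bc bc'; have c0 := block_ge0 bc; have c'0 := block_ge0 bc'.
have [cp pmin] := block_min bc.
split.
- by move=> q; rewrite addr_ge0.
- by rewrite supp_add // => q [/(block_sub bc)|/(block_sub bc')].
- rewrite supp_add //; split; first by left.
  move=> q [/pmin //|c'q].
  apply: leq_trans (proj2 (block_min bc') _ c'q).
  by apply: leq_trans (ltnW Bp); exact: block_supp_le bc cp.
- move=> q; rewrite gtn_max => /andP[Bq B'q].
  by rewrite (block_bound bc Bq) (block_bound bc' B'q) addr0.
- move=> K; rewrite geq_max => /andP[BK B'K].
  by rewrite massD (block_total bc BK) (block_total bc' B'K).
Qed.

(** The partner of [small_average] in a joint induction. A set of order k may carry the whole mass,
    but not if its minimum is at most [L]: for k > 0 it is then a union of at most [L] sets of order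
    k - 1. *)
Definition far_average (k : nat) : Prop :=
  forall (M : set posnat) (L : nat) (d : R), infinite_set M -> 0 < d ->
  exists P : nat, forall p : posnat, M p -> (P <= p)%N ->
  exists c B, [/\ block M p B 1 c, S (cnat k) (supp c) &
    forall K G, S (cnat k) G -> (exists2 q, G q & (q <= L)%N) ->
      mass K G c <= d].

Definition small_average (k : nat) : Prop :=
  forall (M : set posnat) (d : R), infinite_set M -> 0 < d ->
  exists P : nat, forall p : posnat, M p -> (P <= p)%N ->
  exists c B, [/\ block M p B 1 c, S (cnat k.+1) (supp c) &
    forall K G, S (cnat k) G -> mass K G c <= d].

Lemma supp_delta p : supp (fun q => (q == p)%:R : R) = [set p].
Proof.
rewrite seteqP; split=> q; rewrite /supp /=; last by move=> ->;
  rewrite eqxx oner_eq0.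
by case: (q =P p) => // _; rewrite mulr0n eqxx.
Qed.

Lemma sum_delta K (p : posnat) (f : posnat -> R) : (p <= K)%N ->
  \sum_(i < K) (pos i == p)%:R * f (pos i) = f p.
Proof.
move=> pK; have pK' : ((pval p).-1 < K)%N by rewrite prednK ?posnat_gt0.
rewrite (bigD1 (Ordinal pK')) //= pos_predK eqxx mul1r big1 ?addr0 // => i ip.
case: eqP => [e|_]; last by rewrite mul0r.
by exfalso; move/eqP: ip; apply; apply: val_inj; rewrite /= -e.
Qed.

Lemma far_average0 : far_average 0.
Proof.
move=> M L d Minf d0; exists L.+1 => p Mp Lp.
exists (fun q => (q == p)%:R), p; split.
- split.
  + by move=> q; rewrite ler0n.
  + by rewrite supp_delta => q ->.
  + by rewrite supp_delta; split=> // q ->.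
  + by move=> q pq; case: eqP => // qp; move: pq; rewrite qp ltnn.
  + move=> K pK; rewrite mass_total -[RHS](@sum_delta K p (fun=> 1) pK).
    by apply: eq_bigr => i _; rewrite mulr1.
- by rewrite supp_delta; apply: schreier_set1; exact: ceq_refl.
- move=> K G /schreierZ[->|[r ->]] [q] //= -> rL.
  rewrite /mass big1 ?ltW // => i /asboolP /= ->.
  by case: eqP => // rp; move: Lp; rewrite -rp ltnNge rL.
Qed.

Lemma small_far_average k : small_average k -> far_average k.+1.
Proof.
move=> sm M L d Minf d0.
have d'0 : 0 < d / L.+1%:R by rewrite divr_gt0 // ltr0n.
have [P hP] := sm M _ Minf d'0; exists P => p Mp Pp.
have [c [B [bc Sc sc]]] := hP p Mp Pp; exists c, B; split=> // K G.
move=> /(schreierSP hlad)[->|[r [F [FS rG eG]]]] [q] // Gq qL.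
rewrite eG.
apply: le_trans (mass_bigcup (block_ge0 bc) (fun i ir => sc K _ (FS i ir))) _.
rewrite -[leLHS]mulr_natr mulrAC ler_pdivrMr ?ltr0n // ler_pM2l // ler_nat.
by apply: leqW; exact: leq_trans (rG _ Gq) qL.
Qed.

(** The witness averages [N.+1] successive blocks, each chosen with [L] the end of the preceding
    ones. A set of order k has mass at most 1 on the first block it meets and at most d / 2 on each
    later one, hence at most (1 + N d / 2) / (N + 1) <= d on the average. *)
Lemma far_small_average k : far_average k -> small_average k.
Proof.
move=> far M d Minf d0; have d20 : 0 < d / 2 by rewrite divr_gt0.
have [N hN] : exists N : nat, (d / 2)^-1 <= N.+1%:R.
  by exists (Num.bound (d / 2)^-1);
    rewrite ltW // (lt_le_trans (archi_boundP _)) ?ler_nat // invr_ge0 ltW.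
have [P0 hP0] := far M 0%N _ Minf d20.
(* A minimum of at least [N.+1] makes a union of [N.+1] supports admissible. *)
exists (maxn P0 N.+1) => p Mp; rewrite geq_max => /andP[P0p Np].
have hC r : exists c B, [/\ block M p B r.+1%:R c,
    chain lad (cnat k) r.+1 (supp c) &
    forall K G, S (cnat k) G -> mass K G c <= 1 + (d / 2) *+ r].
  elim: r => [|r [c [B [bc ch sc]]]].
    have [c [B [bc Sc _]]] := hP0 p Mp P0p; exists c, B; split=> //.
      exact: chain1.
    by move=> K G _; rewrite mulr0n addr0; exact: block_mass_le bc.
  have [P hP] := far M B _ Minf d20.
  have [p' Mp'] := infinite_posnat_ge (maxn P B.+1) Minf.
  rewrite geq_max => /andP[Pp' Bp'].
  have [c' [B' [bc' Sc' sc']]] := hP p' Mp' Pp'.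
  have c0 := block_ge0 bc; have c'0 := block_ge0 bc'.
  exists (fun q => c q + c' q), (maxn B B'); split.
  - by rewrite -[r.+2%:R]natr1; exact: block_add bc bc'.
  - rewrite supp_add //; apply: chainS => // q q' cq c'q'.
    apply: leq_ltn_trans (block_supp_le bc cq) _.
    by apply: leq_trans Bp' _; apply: (proj2 (block_min bc')).
  - move=> K G SG; rewrite massD.
    have [GB|GB] := pselect (exists2 q, G q & (q <= B)%N).
      by rewrite mulrSr addrA; apply: lerD; [exact: sc | exact: sc'].
    rewrite {1}/mass big1 ?add0r.
      apply: le_trans (block_mass_le _ _ bc') _.
      by rewrite lerDl mulrn_wge0 // ltW.
    move=> i /asboolP Gi; apply: (block_bound bc).
    by rewrite ltnNge; apply/negP => iB; apply: GB; exists (pos i).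
have [c [B [bc ch sc]]] := hC N.
have N0 : 0 < (N.+1)%:R^-1 :> R by rewrite invr_gt0 ltr0n.
have suppE : supp (fun q => N.+1%:R^-1 * c q) = supp c.
  rewrite seteqP; split=> q; rewrite /supp /= mulf_eq0 negb_or.
    by case/andP.
  by move=> ->; rewrite gt_eqF.
exists (fun q => N.+1%:R^-1 * c q), B; split.
- case: bc => c0 cM cmin cB ct; split; rewrite ?suppE //.
  + by move=> q; rewrite mulr_ge0 // ltW.
  + by move=> q /cB->; rewrite mulr0.
  + by move=> K /ct h; rewrite massZ h mulVf // pnatr_eq0.
- rewrite suppE; apply: schreier_chain ch _; first exact: ceq_refl.
  by move=> q cq; apply: leq_trans Np _; apply: (proj2 (block_min bc)).
- move=> K G SG; rewrite massZ ler_pdivrMl ?ltr0n //.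
  apply: le_trans (sc K G SG) _.
  have h1 : 1 <= N.+1%:R * (d / 2) by rewrite -ler_pdivrMr ?mul1r.
  rewrite -[(d / 2) *+ N]mulr_natl.
  have h2 : N%:R * (d / 2) <= N.+1%:R * (d / 2) by rewrite ler_pM2r // ler_nat.
  have -> : N.+1%:R * d = N.+1%:R * (d / 2) + N.+1%:R * (d / 2).
    by rewrite -mulrDr -splitr.
  exact: lerD.
Qed.

Lemma averages k : small_average k.
Proof.
apply: far_small_average; elim: k => [|k IH]; first exact: far_average0.
by apply: small_far_average; exact: far_small_average.
Qed.

End Averages.

(** * Upper bound for the functionals of W on branches *)

Section Weights.
Context (R : realType) (m n : nat -> nat) (hmn : is_weights R m n).
Local Open Scope ring_scope.

Lemma weights_n_le i j : (i <= j)%N -> (n i <= n j)%N.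
Proof.
by rewrite leq_eqVlt => /orP[/eqP->//|/(weights_n_incr hmn)/ltnW].
Qed.

Lemma weights_m_le i j : (i <= j)%N -> (m i <= m j)%N.
Proof.
by rewrite leq_eqVlt => /orP[/eqP->//|/(weights_m_incr hmn)/ltnW].
Qed.

Lemma weights_m_inj i j : m i = m j -> i = j.
Proof.
by move=> e; case: (ltngtP i j) => // /(weights_m_incr hmn); rewrite e ltnn.
Qed.

Lemma weights_m_sqr i j : (0 < i)%N -> (i < j)%N -> (m i ^ 2 <= m j)%N.
Proof.
move=> i0 ij; apply: leq_trans (weights_m_le ij).
exact: (weights_m hmn (j := i.+1)).
Qed.

Lemma weights_m_exp j : (2 ^ j.+1 <= m j)%N.
Proof.
elim: j => [|j IH]; first by rewrite (weights_m0 hmn).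
case: j IH => [_|j IH]; first by rewrite (weights_m1 hmn).
apply: leq_trans (weights_m hmn (j := j.+2) isT).
rewrite /= expnS -mulnn leq_mul // (leq_trans _ IH) //.
by rewrite -{1}(expn1 2) leq_pexp2l.
Qed.

Lemma weights_m_gt0 j : (0 < m j)%N.
Proof. by apply: leq_trans (weights_m_exp j); rewrite expn_gt0. Qed.

Lemma weights_log j : (0 < j)%N ->
  (n j.-1 + trunc_log 2 (m j ^ 2) < n j)%N.
Proof.
case: j => // -[|j] _.
  (* For j = 1, which [weights_n] does not cover, the claim is 1 + log_2 16 < 6. *)
  by rewrite /= (weights_n0 hmn) (weights_n1 hmn) (weights_m1 hmn)
    (@trunc_log_eq 2 4 _ isT).
rewrite -(ltr_nat R) natrD addrC.
apply: le_lt_trans (weights_n hmn (j := j.+2) isT).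
rewrite lerD2r; have ln2 : 0 < ln 2 :> R by rewrite ln_gt0 // ltr1n.
rewrite ler_pdivlMr // mulr_natl -lnXn ?ltr0n //.
rewrite ler_ln ?posrE ?exprn_gt0 ?ltr0n ?weights_m_gt0 //.
by rewrite -!natrX ler_nat trunc_logP // expn_gt0 weights_m_gt0.
Qed.

End Weights.

Section Upper.
Context (R : realType) (lad : cord -> posnat -> cord)
  (m n : nat -> nat) (hmn : is_weights R m n)
  (sigma : seq wfun -> nat) (hsigma : is_coding m sigma) (xi : cord).
Local Open Scope ring_scope.
Local Notation S := (schreier lad).
Local Notation TT := (Ttilde lad m n sigma xi).

(* W_G with the pairs of its G_1 leaves recorded in X *)
Inductive decomposable (X : set wfun) : (posnat -> R) -> Prop :=
| decomposable_G f : G lad m n f -> (forall t, G1_pair lad m n f t -> X t) ->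
    decomposable X f
| decomposable_half d F f : (forall i, (i < d)%N -> decomposable X (F i)) ->
    admissible_half d F f -> decomposable X f.

Lemma finite_set_size_lt (T : Type) (A : set (seq T)) : finite_set A ->
  exists N, forall s, A s -> (size s < N)%N.
Proof.
move=> /(@finite_image _ _ _ size) fA.
have [|N hN] := @finite_pbounded (pos @` (size @` A));
  first exact: finite_image.
exists N => s As; apply: (@leq_trans (pos (size s))) => //=; apply: ltnW.
by apply: hN; exists (size s) => //; exists s.
Qed.

Lemma W_decomposable f : W lad m n sigma xi f ->
  exists2 X, ess_incomparable lad m n sigma xi X & decomposable X f.
Proof.
move=> [_ [A [F [tA ess]]]]; eexists; first exact: ess.
set X := [set t | _]; have [A0 <-] := analysis_root tA.
have [N hN] := finite_set_size_lt (analysis_finite tA).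
(* Descending induction on the length of the address, which [N] bounds. *)
suff h k s : A s -> (N <= size s + k)%N -> decomposable X (F s).
  by apply: (h N).
elim: k s => [|k IH] s As; first by rewrite addn0 leqNgt hN.
move=> Nk; have [ms|nms] := pselect (maximal_node A s).
  apply: decomposable_G; first exact: (analysis_max tA).
  by move=> t ht; exists s.
have [d [hd adm]] := analysis_half tA As nms.
apply: decomposable_half adm => i id; apply: IH; first exact/hd.
by rewrite size_rcons addSnnS.
Qed.

Lemma admissible_halfE d F (f : posnat -> R) i q : admissible_half d F f ->
  (i < d)%N -> F i q != 0 -> f q = 2^-1 * F i q.
Proof.
move=> [_ _ Flt _ ->] id Fi.
rewrite /GRing.scale /= fct_sumE (bigD1 (Ordinal id)) //= big1 ?addr0 // =>
  i' ii'.
apply/eqP; apply: contrapT => /negP Fi'.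
case: (ltngtP i i') => h; last by move/eqP: ii'; apply; apply: val_inj.
- by have := Flt i i'; rewrite h ltn_ord => /(_ isT q q Fi Fi'); rewrite ltnn.
- by have := Flt i' i; rewrite h id => /(_ isT q q Fi' Fi); rewrite ltnn.
Qed.

Lemma admissible_half_at d F (f : posnat -> R) q : admissible_half d F f ->
  f q = 0 \/ exists i, [/\ (i < d)%N, F i q != 0 & f q = 2^-1 * F i q].
Proof.
move=> adm; have [h|h] := pselect (exists2 i, (i < d)%N & F i q != 0).
  by case: h => i id Fi; right; exists i; split=> //;
    exact: admissible_halfE adm id Fi.
left; case: adm => _ _ _ _ ->;
  rewrite /GRing.scale /= fct_sumE big1 ?scaler0 // => i _.
by apply/eqP; apply: contrapT => /negP Fi; apply: h; exists i.
Qed.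

Lemma G0_at (f : posnat -> R) : G0 f ->
  exists p, supp f = [set p] /\ `|f p| = 1.
Proof.
move=> [p hp]; exists p.
have [f0 fp] : (forall q, q != p -> f q = 0) /\ `|f p| = 1.
  case: hp => ->; rewrite /unit_vec /GRing.opp /= ?normrN eqxx normr1;
    split=> // q /negPf->;
  by rewrite ?oppr0.
split=> //; rewrite seteqP; split=> q; rewrite /supp /=.
  by move=> fq; apply/eqP; apply: contraNT fq => /f0->.
by move=> ->; rewrite -normr_gt0 fp.
Qed.

Lemma sign_valued_norm (g : posnat -> int) q : sign_valued g ->
  `|(g q)%:~R : R| = (g q != 0)%:R.
Proof.
move=> /(_ q); rewrite !inE => /or3P[] /eqP->;
  rewrite ?normr0 ?normrN ?normr1 //.
Qed.

Lemma G1_at (f : posnat -> R) t q : G1_pair lad m n f t ->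
  `|f q| = t.2%:R^-1 * (t.1 q != 0)%:R.
Proof.
move=> [sg -> _]; by rewrite normrM sign_valued_norm // ger0_norm.
Qed.

Lemma G1_supp (f : posnat -> R) t : G1_pair lad m n f t -> supp f = supp t.1.
Proof.
move=> ft; have [_ _ [j [_ tj _]]] := ft.
have t0 : t.2%:R^-1 != 0 :> R.
  by rewrite invr_eq0 pnatr_eq0 tj -lt0n (weights_m_gt0 hmn).
rewrite seteqP; split=> q; rewrite /supp /= -?(normr_eq0 (f q)) (G1_at _ ft).
  by rewrite mulf_eq0 negb_or => /andP[_]; case: (t.1 q != 0);
    rewrite ?mulr0n ?eqxx.
by move=> ->; rewrite mulr1.
Qed.

Lemma decomposable_le1 X f q : decomposable X f -> `|f q| <= 1.
Proof.
elim=> {f} [f Gf _|d F f _ IH adm].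
  case: Gf => [/G0_at[p [sf fp]]|[t ft]].
    have [->|] := eqVneq (f q) 0; first by rewrite normr0.
    move=> fq; have : supp f q by [].
    by rewrite sf => ->; rewrite fp.
  rewrite (G1_at _ ft); have [_ _ [j [_ -> _]]] := ft.
  rewrite mulr_ile1 ?invr_ge0 ?ler0n ?lern1 ?leq_b1 //.
  by rewrite invf_le1 ?ltr0n ?ler1n (weights_m_gt0 hmn).
case: (admissible_half_at q adm) => [->|[i [id _ ->]]]; first by rewrite normr0.
rewrite normrM ger0_norm ?invr_ge0 // mulr_ile1 ?invr_ge0 //; last exact: IH.
by rewrite invf_le1 ?ltr0n // ler1n.
Qed.

(* Outside a Schreier set of low complexity, every coefficient of f is either
   halved more than D times or comes from a leaf of weight index above l. *)
Lemma decomposable_split X f : decomposable X f -> forall l D, exists Q,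
  [/\ S (cnat (n l + D)) Q, Q `<=` supp f & forall q, f q != 0 -> ~ Q q ->
    `|f q| <= 2^-1 ^+ D.+1 \/
    exists t j, [/\ X t, t.2 = m j, (l < j)%N, t.1 q != 0 &
                    `|f q| <= (m j)%:R^-1]].
Proof.
elim=> {f} [f Gf fX|d F f Fdec IH adm] l D.
  case: Gf => [/G0_at[p [sf fp]]|[t ft]].
    exists [set p]; rewrite sf; split=> //.
      by apply: (@schreier_cnat_le _ 0) => //; apply: schreier_set1;
        exact: ceq_refl.
    by move=> q fq; have : supp f q by []; rewrite sf.
  have [_ _ [j [j0 tj St]]] := ft; case: (leqP j l) => jl.
    exists (supp f); rewrite {1}(G1_supp ft); split=> //.
    apply: schreier_cnat_le St; apply: leq_trans (leq_addr _ _).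
    exact: (weights_n_le hmn).
  exists set0; split=> //.
    by apply: (@schreier_cnat_le _ 0) => //; apply: schreier_set0;
      exact: ceq_refl.
  move=> q fq _; right; exists t, j; split=> //; first exact: fX.
    by have : supp f q by []; rewrite (G1_supp ft).
  by rewrite (G1_at _ ft) tj ler_piMr ?invr_ge0 // lern1 leq_b1.
have half x : `|2^-1 * x| = 2^-1 * `|x| :> R by rewrite normrM ger0_norm
  ?invr_ge0.
(* Below a halving node the budget [D] drops by one, and uniting the sets found for the [d]
   successors raises the Schreier order by one, since all supports start at [d] or later. If [D] is
   0, the halving at this node already suffices. *)
case: D => [|D].
  exists set0; split=> //.
    by apply: (@schreier_cnat_le _ 0) => //; apply: schreier_set0;
      exact: ceq_refl.
  move=> q fq _; left; case: (admissible_half_at q adm) => [f0|[i [id _ ->]]].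
    by rewrite f0 eqxx in fq.
  rewrite half expr1 ler_piMr ?invr_ge0 //; exact: decomposable_le1 (Fdec i id).
have /choice[Q hQ] : forall i, exists Q, (i < d)%N ->
  [/\ S (cnat (n l + D)) Q, Q `<=` supp (F i) & forall q, F i q != 0 -> ~ Q q ->
    `|F i q| <= 2^-1 ^+ D.+1 \/
    exists t j, [/\ X t, t.2 = m j, (l < j)%N, t.1 q != 0 &
                    `|F i q| <= (m j)%:R^-1]].
  move=> i; case: (ltnP i d) => id; last by exists set0.
  by have [Q hQ] := IH i id l D; exists Q.
have [d0 F0 Flt dF fE] := adm.
exists (\bigcup_(i in [set i | (i < d)%N]) Q i); split.
- rewrite addnS; apply: schreier_chain (ceq_refl _) _ _.
    apply: chain_bigcup => [i /hQ[]//|i j ijd p q].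
    have /andP[ij jd] := ijd.
    move=> /(let: And3 _ h _ := hQ i (ltn_trans ij jd) in h) Fip.
    move=> /(let: And3 _ h _ := hQ j jd in h) Fjq.
    exact: Flt ijd _ _ Fip Fjq.
  move=> p [i /= id]; have [_ h _] := hQ i id; move=> /h Fp.
  case: i id {h} Fp => [|i] id Fp; first exact: dF.
  have [q Fq] : exists q, F 0%N q != 0.
    apply: contrapT => h; apply: (F0 0%N d0); apply/funext => q.
    by apply/eqP; apply: contrapT => /negP Fq; apply: h; exists q.
  by apply: leq_trans (dF _ Fq) _; apply: ltnW; apply: (Flt 0%N i.+1).
- move=> q [i /= id]; have [_ h _] := hQ i id; move=> /h Fiq.
  rewrite /supp /= (admissible_halfE adm id Fiq) mulf_eq0 negb_or invr_eq0.
  by rewrite pnatr_eq0.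
- move=> q fq nQ; case: (admissible_half_at q adm) => [f0|[i [id Fi ->]]].
    by rewrite f0 eqxx in fq.
  have [_ _ h] := hQ i id; rewrite half.
  have [|le|[t [j [Xt tj lj tq le]]]] := h q Fi.
  + by move=> Qq; apply: nQ; exists i.
  + by left; rewrite exprS ler_pM2l // invr_gt0.
  + right; exists t, j; split=> //; apply: le_trans le.
    by rewrite ler_piMl // invf_le1 ?ltr0n // ler1n.
Qed.

(** [h] records whether a leaf of weight m_j meets the vector. Pointwise, |f(q) m_j c(q)| is at most
    h |c(q)| at such leaves, |c(q)| / m_j at the other points outside the exceptional set [Q], and
    m_j |c(q)| on [Q]. *)
Lemma pairing_bound X f j (c : posnat -> R) K (A h : R) :
  decomposable X f -> (0 < j)%N -> 0 <= A -> 0 <= h ->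
  mass K setT (fun q => `|c q|) <= A ->
  (forall E, S (cnat (n j).-1) E ->
     mass K E (fun q => `|c q|) <= A / (m j)%:R ^+ 2) ->
  (forall t q, X t -> t.2 = m j -> c q != 0 -> t.1 q != 0 -> 1 <= h) ->
  `|\sum_(i < K) f (pos i) * ((m j)%:R * c (pos i))| <= A * h + 2 * A / (m
    j)%:R.
Proof.
move=> df j0 A0 h0 cA cE hh.
have mj0 : 0 < (m j)%:R :> R by rewrite ltr0n (weights_m_gt0 hmn).
have [Q [SQ Qf hQ]] := decomposable_split df j.-1 (trunc_log 2 (m j ^ 2)).
have {}SQ : S (cnat (n j).-1) Q.
  apply: schreier_cnat_le SQ; have := weights_log hmn j0.
  by move=> lt; rewrite -ltnS prednK // (leq_ltn_trans _ lt).
have pt q : `|f q * ((m j)%:R * c q)| <=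
    h * `|c q| + (m j)%:R^-1 * `|c q| + (if `[< Q q >] then (m j)%:R * `|c q|
      else 0).
  rewrite !normrM [`|(m j)%:R|]ger0_norm ?ler0n //.
  have [->|cq] := eqVneq (c q) 0.
    by rewrite normr0 !mulr0; case: ifP; rewrite !addr0.
  case: asboolP => Qq.
    apply: (@le_trans _ _ ((m j)%:R * `|c q|)).
      by rewrite ler_piMl ?mulr_ge0 ?ler0n //; exact: decomposable_le1 df.
    by rewrite lerDr addr_ge0 // mulr_ge0 // invr_ge0 ltW.
  rewrite addr0 mulrA -mulrDl ler_wpM2r //.
  have [->|fq] := eqVneq (f q) 0.
    by rewrite normr0 mul0r addr_ge0 // invr_ge0 ltW.
  rewrite -ler_pdivlMr // mulrDl.
  have hm0 : 0 <= h / (m j)%:R by rewrite divr_ge0 // ltW.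
  case: (hQ q fq Qq) => [le|[t [i [Xt ti ji tq le]]]].
    apply: le_trans le _; rewrite -[leLHS]add0r lerD // -invfM exprVn.
    rewrite lef_pV2 ?posrE ?exprn_gt0 ?mulr_gt0 //.
    rewrite -expr2 -!natrX ler_nat; apply: ltnW; exact: trunc_log_ltn.
  apply: le_trans le _.
  have [ij|ij] := eqVneq i j.
    rewrite ij -[leLHS]mul1r -[leLHS]addr0 lerD ?mulr_ge0 ?invr_ge0 //.
    by rewrite ler_wpM2r ?invr_ge0 //; apply: (hh t q) => //; rewrite ti ij.
  rewrite -[leLHS]add0r lerD // -invfM lef_pV2 ?posrE ?mulr_gt0 //; last first.
    by rewrite ltr0n (weights_m_gt0 hmn).
  rewrite -expr2 -natrX ler_nat; apply: (weights_m_sqr hmn) => //.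
  by rewrite ltn_neqAle eq_sym ij; case: (j) j0 ji.
apply: le_trans (ler_norm_sum _ _ _) _.
apply: le_trans; first by apply: ler_sum => i _; exact: (pt (pos i)).
rewrite !big_split /= -!mulr_sumr -big_mkcond -mulr_sumr /=.
rewrite -(mass_total K (fun q => `|c q|)).
have -> : A * h + 2 * A / (m j)%:R =
    h * A + (m j)%:R^-1 * A + (m j)%:R * (A / (m j)%:R ^+ 2) by field;
      rewrite gt_eqF.
apply: lerD; first by apply: lerD; rewrite ler_wpM2l // invr_ge0 ltW.
by rewrite ler_wpM2l ?ler0n //; exact: cE.
Qed.

Lemma Ttilde_weights s : TT s -> exists js : nat -> nat,
  [/\ forall i, (i < size s)%N -> (0 < js i)%N /\ (entry s i).2 = m (js i),
      forall i i', (i < i' < size s)%N -> (js i < js i')%N &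
      forall i, (i < size s)%N -> S (cnat (n (js i))) (supp (entry s i).1)].
Proof.
move=> [_ [js [h1 _ [h2 _ h3] _ _]]]; exists js; split=> //.
move=> i i' /h3; apply: contraTT; rewrite -!leqNgt; exact: weights_n_le hmn _ _.
Qed.

Lemma Ttilde_special s : TT s -> special_seq m s.
Proof.
move=> Ts; have [js [h1 h2 _]] := Ttilde_weights Ts.
have [s0 [_ [_ [h3 _] _ _ _]]] := Ts; split=> //.
  move=> i si; have [sg fs _] := h3 i si; split=> //.
  by have [j0 ->] := h1 i si; exists (js i).
move=> i i' ii'; have /andP[lt si'] := ii'.
rewrite (proj2 (h1 i (ltn_trans lt si'))) (proj2 (h1 i' si')).
by apply: (weights_m_incr hmn); exact: h2.
Qed.

Lemma Ttilde_full s : (forall i, (i < size s)%N -> TT (take i.+1 s)) ->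
  (0 < size s)%N -> TT s.
Proof.
by case: s => // x s /(_ (size s)) h _; move: h; rewrite /= take_size; exact.
Qed.

Lemma entry_cat (s u : seq wfun) i : (i < size s)%N ->
  entry (s ++ u) i = entry s i.
Proof. by move=> si; rewrite /entry nth_cat si. Qed.

Lemma take_entry (s : seq wfun) i : (i < size s)%N ->
  take i.+1 s = rcons (take i s) (entry s i).
Proof. by move=> si; rewrite (take_nth wfun0). Qed.

Lemma special_seq_cat s u : s <> [::] -> special_seq m (s ++ u) ->
  special_seq m s.
Proof.
move=> s0 [_ h1 h2]; split=> //.
  move=> i si; rewrite -(entry_cat u si); apply: h1.
  by rewrite size_cat (leq_trans si) ?leq_addr.
move=> i i' /andP[ii' si']; have si := ltn_trans ii' si'.
rewrite -(entry_cat u si) -(entry_cat u si'); apply: h2.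
by rewrite ii' size_cat (leq_trans si') ?leq_addr.
Qed.

(* As sigma is injective, a pair of T_xi with the weight of the i'-th entry of
   s extends the first i' entries of s. *)
Lemma ess_incomparable_entry s X t1 t2 i i' :
  (forall i, (i < size s)%N -> TT (take i.+1 s)) ->
  ess_incomparable lad m n sigma xi X -> X t1 -> X t2 ->
  (i < i' < size s)%N -> t1.2 = (entry s i).2 -> t2.2 = (entry s i').2 ->
  set_lt (supp (entry s i).1) (supp t1.1).
Proof.
move=> Ts [XT ess] X1 X2 /andP[ii' si'] w1 w2.
have si := ltn_trans ii' si'.
have Tfull : TT s.
  by apply: Ttilde_full => //; exact: leq_ltn_trans si'.
have [_ _ incr] := Ttilde_special Tfull.
have lastE k : (k < size s)%N -> last wfun0 (take k.+1 s) = entry s k.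
  by move=> sk; rewrite take_entry // last_rcons.
apply: (ess _ _ X1 X2).
  split; last by rewrite w1 w2 => e; have := incr i i';
    rewrite ii' si' e ltnn => /(_ isT).
  exists (take i.+1 s), (take i'.+1 s); split; rewrite ?lastE //; try exact: Ts.
  rewrite /weight_seq !map_take -(take_takel (i := i.+1) (j := i'.+1)) ?ltnS
    1?ltnW //.
  rewrite -[X in prefix _ X](cat_take_drop i.+1); exact: prefix_prefix.
have [s' Ts' ls'] := XT _ X2.
have sp' := Ttilde_special Ts'.
have w2' : t2.2 = sigma (take i' s).
  rewrite w2; have [_ [js [_ _ _ [_ hs] _]]] := Tfull; apply: hs.
  by rewrite si' (leq_ltn_trans _ ii').
have special_i' : special_seq m (take i' s).
  case: i' {w2 w2' incr} ii' si' => // i' _ si'.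
  by apply: Ttilde_special; apply: Ts; exact: ltnW.
case/lastP: s' => [|u x] in Ts' ls' sp'; first by case: sp'.
rewrite last_rcons in ls'; subst x.
have eu : u = take i' s.
  (* If [u] is empty, [t2] has the weight m_1 of the first entry of [s], although weights increase
     strictly along [s] and [i'] is positive. *)
  have [u0|u0] := eqVneq u [::].
    exfalso; have [_ [js [_ _ _ [hs _] _]]] := Ts'.
    have [_ [js' [_ _ _ [hs' _] _]]] := Tfull.
    rewrite u0 /= in hs; have := incr 0%N i'.
    by rewrite -w2 hs' hs ltnn si' (leq_ltn_trans _ ii') // => /(_ isT).
  apply: (coding_inj hsigma) => //.
    by apply: (@special_seq_cat _ [:: t2]); [exact/eqP | rewrite cats1].
  rewrite -w2'; have [_ [js [_ _ _ [_ hs] _]]] := Ts'.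
  have := hs (size u); rewrite size_rcons ltnSn lt0n size_eq0 u0 => /(_ isT) e.
  by rewrite -cats1 take_size_cat // in e;
    rewrite -e cats1 /entry nth_rcons ltnn eqxx.
exists (take i.+1 s), (rcons (drop i.+1 (take i' s)) t2).
have e : take i.+1 s ++ rcons (drop i.+1 (take i' s)) t2 = rcons u t2.
  rewrite -rcons_cat eu -(take_takel (i := i.+1) (j := i')) //.
  by rewrite cat_take_drop.
split; rewrite ?e ?last_rcons ?lastE //; first exact: Ts.
by rewrite w1; case: (entry s i).
Qed.

Lemma sum_half_le1 k : \sum_(i < k) (2^-1 : R) ^+ i.+1 <= 1.
Proof.
have -> : \sum_(i < k) (2^-1 : R) ^+ i.+1 = 1 - 2^-1 ^+ k.
  elim: k => [|k IH]; first by rewrite big_ord0 expr0 subrr.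
  by rewrite big_ord_recr /= IH exprS; field.
by rewrite lerBlDr lerDl exprn_ge0 // invr_ge0.
Qed.

(** Apart from the factor [B], the bound is A from a single index plus the sum of 2 A / m_{j_i} <= 2
    A 2^-(i+1) over all of them. The vector [c i] need not live on the i-th support, only below its
    maximum; the differences in the game use this freedom. *)
Lemma W_upper_bound s (f : posnat -> R) K (c : nat -> posnat -> R)
    (a : nat -> R) (A B : R) (js : nat -> nat) :
  (forall i, (i < size s)%N -> TT (take i.+1 s)) ->
  W lad m n sigma xi f -> 0 <= A -> 0 <= B ->
  (forall i, (i < size s)%N -> (0 < js i)%N /\ (entry s i).2 = m (js i)) ->
  (forall i, (i < size s)%N -> mass K setT (fun q => `|c i q|) <= A) ->
  (forall i, (i < size s)%N -> forall E, S (cnat (n (js i)).-1) E ->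
     mass K E (fun q => `|c i q|) <= A / (m (js i))%:R ^+ 2) ->
  (forall i, (i < size s)%N -> forall q, c i q != 0 ->
     exists2 q', supp (entry s i).1 q' & (q <= q')%N) ->
  (forall i, (i < size s)%N -> `|a i| <= B) ->
  `|\sum_(i < size s) a i *
     \sum_(r < K) f (pos r) * ((m (js i))%:R * c i (pos r))| <= 3 * A * B.
Proof.
move=> Ts /W_decomposable[X ess df] A0 B0 hjs hA hE hs ha.
(* [i0] is the largest index whose weight occurs among the leaves, and arbitrary if none does.
   Leaves with the weight of a smaller index lie beyond the corresponding support, hence beyond
   [c i]. *)
have [i0 hi0] : exists i0, forall i, (i < size s)%N -> i <> i0 ->
    forall t q, X t -> t.2 = m (js i) -> c i q != 0 -> t.1 q != 0 -> False.
  pose I k := `[< (k < size s)%N /\ exists2 t, X t & t.2 = m (js k) >].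
  have [hI|nI] := pselect (exists k, I k); last first.
    exists 0%N => i si _ t q Xt tj _ _; apply: nI; exists i; apply/asboolP.
    by split=> //; exists t.
  have ub k : I k -> (k <= size s)%N by move=> /asboolP[/ltnW].
  case: (ex_maxnP hI ub) => i0 /asboolP[si0 [t0 Xt0 t0j]] mx; exists i0.
  move=> i si ne t q Xt tj cq tq.
  have ii0 : (i < i0)%N.
    rewrite ltn_neqAle; apply/andP; split; first exact/eqP.
    by apply: mx; apply/asboolP; split=> //; exists t.
  have [q' gq' qq'] := hs i si q cq.
  have : set_lt (supp (entry s i).1) (supp t.1).
    apply: (@ess_incomparable_entry s X t t0 i i0) => //; first by rewrite ii0.
      by rewrite tj (proj2 (hjs i si)).
    by rewrite t0j (proj2 (hjs i0 si0)).
  by move=> /(_ q' q gq' tq); rewrite ltnNge qq'.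
have js_gt i : (i < size s)%N -> (i < js i)%N.
  have Tfull : (0 < size s)%N -> TT s.
    exact: Ttilde_full.
  elim: i => [|i IH] si; first by have [] := hjs _ si.
  apply: leq_ltn_trans (IH (ltnW si)) _.
  have [_ _ /(_ i i.+1)] := Ttilde_special (Tfull (leq_ltn_trans (leq0n _) si)).
  rewrite leqnn si => /(_ isT).
  rewrite (proj2 (hjs _ si)) (proj2 (hjs _ (ltnW si))).
  by apply: contraTT; rewrite -!leqNgt; exact: (weights_m_le hmn).
apply: le_trans (ler_norm_sum _ _ _) _.
have bound (i : 'I_(size s)) : `|a i * \sum_(r < K) f (pos r) * ((m (js i))%:R
  * c i (pos r))|
    <= B * (A * ((i : nat) == i0)%:R + 2 * A * 2^-1 ^+ i.+1).
  rewrite normrM; apply: ler_pM => //; first exact: ha.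
  apply: le_trans (@pairing_bound X f (js i) (c i) K A ((i : nat) == i0)%:R df
    _ _ _ _ _ _) _ => //.
  - by have [] := hjs i (ltn_ord i).
  - exact: hA.
  - exact: hE.
  - move=> t q Xt tj cq tq; case: eqP => // ne; exfalso.
    exact: hi0 (ltn_ord i) ne _ _ Xt tj cq tq.
  - rewrite lerD2l ler_wpM2l ?mulr_ge0 //.
    rewrite exprVn lef_pV2 ?posrE ?exprn_gt0 ?ltr0n ?(weights_m_gt0 hmn) //.
    rewrite -natrX ler_nat; apply: leq_trans (weights_m_exp hmn _).
    by rewrite leq_pexp2l // ltnW // ltnS js_gt.
apply: le_trans; first by apply: ler_sum => i _; exact: bound.
rewrite -mulr_sumr big_split /= -!mulr_sumr mulrC ler_wpM2r //.
have -> : 3 * A = A * 1 + 2 * A * 1 by ring.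
apply: lerD; last by rewrite ler_wpM2l ?mulr_ge0 //; exact: sum_half_le1.
rewrite ler_wpM2l //.
have [si0|si0] := ltnP i0 (size s); last first.
  rewrite big1 // => i _; case: eqP => // e.
  by have := ltn_ord i; rewrite e ltnNge si0.
rewrite (bigD1 (Ordinal si0)) //= eqxx big1 ?addr0 // => i ne.
by case: eqP => // e; move/eqP: ne; case; apply: val_inj.
Qed.

End Upper.

(** * Functionals of W and the norm *)

Section Functionals.
Context (R : realType) (lad : cord -> posnat -> cord)
  (m n : nat -> nat) (hmn : is_weights R m n)
  (sigma : seq wfun -> nat) (hsigma : is_coding m sigma) (xi : cord).
Local Open Scope ring_scope.
Local Notation S := (schreier lad).
Local Notation TT := (Ttilde lad m n sigma xi).
Local Notation WW := (@W R lad m n sigma xi).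

Definition chi (F : set posnat) : posnat -> int := fun q => (`[< F q >])%:R.

Lemma chi_supp F : supp (chi F) = F.
Proof.
rewrite seteqP; split=> q; rewrite /supp /chi /=.
  by case: asboolP => // _; rewrite eqxx.
by move=> Fq; case: asboolP.
Qed.

Lemma chi_sign F : sign_valued (chi F).
Proof. by move=> q; rewrite /chi !inE; case: asboolP. Qed.

Lemma G1_pair_inj (f : posnat -> R) t t' : supp t.1 !=set0 ->
  G1_pair lad m n f t -> G1_pair lad m n f t' -> t' = t.
Proof.
move=> [q tq] ft ft'.
have t'q : supp t'.1 q by rewrite -(G1_supp hmn ft') (G1_supp hmn ft).
have ew : t'.2 = t.2.
  have := G1_at q ft; rewrite (G1_at q ft') tq t'q !mulr1 => /invr_inj /eqP.
  by rewrite eqr_nat => /eqP.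
have w0 : t.2%:R^-1 != 0 :> R.
  have [_ _ [j [_ -> _]]] := ft.
  by rewrite invr_eq0 pnatr_eq0 -lt0n (weights_m_gt0 hmn).
case: t t' ft ft' ew w0 {tq t'q} =>
  [g w] [g' w'] /= [_ /= fE _] [_ /= fE' _] ew w0.
rewrite ew in fE' *; congr pair; apply/funext => r.
have := congr1 (fun u => u r) fE; rewrite fE' => /(mulfI w0).
by move/eqP; rewrite eqr_int => /eqP.
Qed.

Lemma W_of_G (f : posnat -> R) : G lad m n f ->
  ess_incomparable lad m n sigma xi [set t | G1_pair lad m n f t] -> WW f.
Proof.
move=> Gf ess; split; first exact: WG_G.
exists [set [::]], (fun=> f); split.
  split=> //.
  - by move=> [|x s] i.
  - by move=> s _; exact: WG_G.
  - move=> s As nm; exfalso; apply: nm; split=> // i; rewrite As /=.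
    by case.
have -> : [set t | exists2 s, maximal_node [set [::]] s & G1_pair lad m n f t] =
   [set t | G1_pair lad m n f t] => //.
rewrite seteqP; split=> t /=; first by case.
by move=> ft; exists [::] => //; split=> // i.
Qed.

(** All weights are at least m_1 = 4, so a unit vector is not in G_1 and its one-node tree analysis
    has no pairs. *)
Lemma unit_vec_W p : WW (unit_vec R p).
Proof.
apply: W_of_G; first by left; exists p; left.
suff no t : ~ G1_pair lad m n (unit_vec R p) t by split=> [t /no|t t' /no].
move=> ft; have := G1_at p ft; rewrite /unit_vec eqxx normr1.
have [_ _ [j [j0 -> _]]] := ft; case: (t.1 p != 0); rewrite ?mulr0 ?mulr1.
  move/eqP; rewrite eq_sym invr_eq1 -[1]/(1%:R) eqr_nat => /eqP e.
  by have := weights_m_le hmn j0; rewrite e (weights_m1 hmn).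
by move/eqP; rewrite oner_eq0.
Qed.

(** A one-point subset of T_xi is essentially incomparable, as [Wtree_lt] demands distinct
    weights. *)
Lemma leaf_W s g w : TT s -> last wfun0 s = (g, w) ->
  WW (fun q => w%:R^-1 * (g q)%:~R).
Proof.
move=> Ts ls; have [s0 [js [h1 [h2 _] [h3 _ _] _ _]]] := Ts.
have lt : ((size s).-1 < size s)%N.
  by case: (s) s0 => //= x u _; rewrite ltnSn.
have es : entry s (size s).-1 = (g, w) by rewrite /entry nth_last.
have ft : G1_pair lad m n (fun q => w%:R^-1 * (g q)%:~R : R) (g, w).
  have [sg _ _] := h2 _ lt; have [j0 wj] := h1 _ lt; have := h3 _ lt.
  rewrite es /= in sg wj * => Sg; split=> //.
  by exists (js (size s).-1).
have g0 : supp (g, w).1 !=set0 by have [_ _] := h2 _ lt; rewrite es.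
have uni t := @G1_pair_inj _ _ t g0 ft.
apply: W_of_G; first by right; exists (g, w).
split=> [t /uni ->|t t' /uni -> /uni -> [_ //]].
by exists s.
Qed.

End Functionals.

(** * Finite sums and linear combinations *)

Section Sums.
Context (R : realType).
Local Open Scope ring_scope.

Lemma fsbig_pos (V : zmodType) (x : posnat -> R) (F : posnat -> V) K :
  (forall q : posnat, (K < q)%N -> x q = 0) -> (forall q, x q = 0 -> F q = 0) ->
  \sum_(p \in supp x) F p = \sum_(i < K) F (pos i).
Proof.
move=> xK xF; rewrite (@fsbig_fwiden _ _ _ _ (map pos (iota 0 K))).
- by rewrite big_map -[X in iota _ X]subn0 -/(index_iota 0 K) big_mkord.
- move=> q /eqP xq; have qK : (pval q <= K)%N by rewrite leqNgt;
  apply/negP => /xK.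
  apply/mapP; exists (pval q).-1; last by rewrite pos_predK.
  by rewrite mem_iota add0n /= prednK ?posnat_gt0.
- by rewrite map_inj_uniq ?iota_uniq //; exact: pos_inj.
- by move=> q [_ /negP/negPn/eqP/xF].
Qed.

Lemma c00_bound (x : posnat -> R) K :
  (forall q : posnat, (K < q)%N -> x q = 0) -> @c00 R x.
Proof.
move=> xK; apply: pbounded_finite; exists K.+1 => q /eqP xq.
by rewrite ltnS leqNgt; apply/negP => /xK.
Qed.

Lemma pairingE (f x : posnat -> R) K : (forall q : posnat, (K < q)%N ->
  x q = 0) ->
  pairing f x = \sum_(i < K) f (pos i) * x (pos i).
Proof. by move=> xK; apply: fsbig_pos => // q ->; rewrite mulr0. Qed.

Context (X : completeNormedModType R) (e : posnat -> X).

Lemma lincombE (x : posnat -> R) K : (forall q : posnat, (K < q)%N ->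
  x q = 0) ->
  lincomb e x = \sum_(i < K) x (pos i) *: e (pos i).
Proof. by move=> xK; apply: fsbig_pos => // q ->; rewrite scale0r. Qed.

Lemma lincomb_sum k (a : nat -> R) (x : nat -> posnat -> R) K :
  (forall i, (i < k)%N -> forall q : posnat, (K < q)%N -> x i q = 0) ->
  \sum_(i < k) a i *: lincomb e (x i) =
  lincomb e (fun q => \sum_(i < k) a i * x i q).
Proof.
move=> xK; rewrite (@lincombE _ K); last first.
  by move=> q Kq; rewrite big1 // => i _; rewrite xK ?mulr0.
rewrite (eq_bigr (fun i : 'I_k =>
  \sum_(r < K) (a i * x i (pos r)) *: e (pos r))).
  by rewrite exchange_big; apply: eq_bigr => r _; rewrite scaler_suml.
move=> i _; rewrite (@lincombE _ K); last exact: xK.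
by rewrite scaler_sumr; apply: eq_bigr => r _; rewrite scalerA.
Qed.

Lemma lincombN (x : posnat -> R) K : (forall q : posnat, (K < q)%N ->
  x q = 0) ->
  lincomb e (fun q => - x q) = - lincomb e x.
Proof.
move=> xK; rewrite (lincombE xK) (@lincombE _ K); last first.
  by move=> q /xK->; rewrite oppr0.
by rewrite -sumrN; apply: eq_bigr => r _; rewrite scaleNr.
Qed.

Lemma lincombB (x y : posnat -> R) K : (forall q : posnat, (K < q)%N ->
  x q = 0) ->
  (forall q : posnat, (K < q)%N -> y q = 0) ->
  lincomb e (fun q => x q - y q) = lincomb e x - lincomb e y.
Proof.
move=> xK yK; rewrite (lincombE xK) (lincombE yK) (@lincombE _ K).
  by rewrite -sumrB; apply: eq_bigr => r _; rewrite scalerBl.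
by move=> q Kq; rewrite xK // yK // subr0.
Qed.

End Sums.

(** * Norm estimates in the completion *)

Section Norm.
Context (R : realType) (lad : cord -> posnat -> cord)
  (m n : nat -> nat) (hmn : is_weights R m n)
  (sigma : seq wfun -> nat) (hsigma : is_coding m sigma) (xi : cord)
  (X : completeNormedModType R) (e : posnat -> X)
  (hX : is_completion (normW lad m n sigma xi) e).
Local Open Scope ring_scope.
Local Notation S := (schreier lad).
Local Notation TT := (Ttilde lad m n sigma xi).
Local Notation WW := (@W R lad m n sigma xi).

(** The supremum defining the norm carries no absolute value. Testing [f] on both x and -x, which
    have the same norm in X, replaces an argument about -f. *)
Lemma pairing_le_norm (f x : posnat -> R) K : WW f ->
  (forall q : posnat, (K < q)%N -> x q = 0) ->
  `|pairing f x| <= `|lincomb e x|.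
Proof.
move=> Wf xK.
have pos_le y : (forall q : posnat, (K < q)%N -> y q = 0) ->
    pairing f y <= `|lincomb e y|.
  move=> yK; rewrite (completion_norm hX (c00_bound yK)).
  apply: sup_ubound; last by exists f.
  exists (\sum_(i < K) `|y (pos i)|) => _ [g Wg ->].
  rewrite (pairingE _ yK); apply: le_trans (ler_norm _) _.
  apply: le_trans (ler_norm_sum _ _ _) _; apply: ler_sum => i _.
  have [Y _ dg] := W_decomposable Wg.
  by rewrite normrM ler_piMl //; exact: (decomposable_le1 hmn _ dg).
rewrite ler_norml pos_le // andbT lerNl.
have NxK (q : posnat) : (K < q)%N -> - x q = 0 by move=> /xK->; rewrite oppr0.
have := pos_le _ NxK; rewrite (lincombN _ xK) normrN; apply: le_trans.
rewrite (pairingE _ xK) (pairingE _ NxK) -sumrN le_eqVlt; apply/orP; left.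
by apply/eqP/eq_bigr => i _; rewrite mulrN.
Qed.

Lemma norm_le (x : posnat -> R) K b : (forall q : posnat, (K < q)%N ->
  x q = 0) ->
  (forall f, WW f -> \sum_(i < K) f (pos i) * x (pos i) <= b) ->
  `|lincomb e x| <= b.
Proof.
move=> xK hb; rewrite (completion_norm hX (c00_bound xK)).
apply: ge_sup.
  have h := unit_vec_W lad hmn sigma xi (pos 0).
  by exists (pairing (unit_vec R (pos 0)) x), (unit_vec R (pos 0)).
by move=> _ [f Wf ->]; rewrite (pairingE _ xK); exact: hb.
Qed.

Lemma norm_leaf s g w (x : posnat -> R) K : TT s -> last wfun0 s = (g, w) ->
  (forall q : posnat, (K < q)%N -> x q = 0) ->
  `|\sum_(i < K) w%:R^-1 * (g (pos i))%:~R * x (pos i)| <= `|lincomb e x|.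
Proof.
move=> Ts ls xK; rewrite -(pairingE (fun q => w%:R^-1 * (g q)%:~R) xK).
by apply: pairing_le_norm xK; exact: leaf_W ls.
Qed.

Lemma norm_upper_bound s K (c : nat -> posnat -> R)
    (a : nat -> R) (A B : R) (js : nat -> nat) :
  (forall i, (i < size s)%N -> TT (take i.+1 s)) -> 0 <= A -> 0 <= B ->
  (forall i, (i < size s)%N -> (0 < js i)%N /\ (entry s i).2 = m (js i)) ->
  (forall i, (i < size s)%N -> forall q : posnat, (K < q)%N -> c i q = 0) ->
  (forall i, (i < size s)%N -> mass K setT (fun q => `|c i q|) <= A) ->
  (forall i, (i < size s)%N -> forall E, S (cnat (n (js i)).-1) E ->
     mass K E (fun q => `|c i q|) <= A / (m (js i))%:R ^+ 2) ->
  (forall i, (i < size s)%N -> forall q, c i q != 0 ->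
     exists2 q', supp (entry s i).1 q' & (q <= q')%N) ->
  (forall i, (i < size s)%N -> `|a i| <= B) ->
  `|\sum_(i < size s) a i *: lincomb e (fun q => (m (js i))%:R * c i q)|
    <= 3 * A * B.
Proof.
move=> Ts A0 B0 hjs cK hA hE hs ha.
have mcK i : (i < size s)%N -> forall q : posnat, (K < q)%N ->
    (m (js i))%:R * c i q = 0.
  by move=> si q Kq; rewrite cK ?mulr0.
rewrite (lincomb_sum _ a mcK).
apply: (@norm_le _ K); first by move=> q Kq; rewrite big1 // => i _;
  rewrite mcK ?mulr0.
move=> f Wf; have U := W_upper_bound hmn hsigma Ts Wf A0 B0 hjs hA hE hs ha;
  apply: le_trans U.
apply: le_trans _ (ler_norm _); rewrite le_eqVlt; apply/orP; left; apply/eqP.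
under eq_bigr do rewrite mulr_sumr.
rewrite exchange_big; apply: eq_bigr => i _; rewrite mulr_sumr.
by apply: eq_bigr => r _; rewrite mulrCA.
Qed.

End Norm.

(** * Extending branches *)

Section Extension.
Context (R : realType) (lad : cord -> posnat -> cord)
  (m n : nat -> nat) (hmn : is_weights R m n)
  (sigma : seq wfun -> nat) (hsigma : is_coding m sigma) (xi : cord).
Local Notation S := (schreier lad).
Local Notation TT := (Ttilde lad m n sigma xi).

Definition minima (s : seq wfun) : set posnat :=
  [set p | exists2 i, (i < size s)%N & is_min (supp (entry s i).1) p].

(** Asking this of every initial segment takes the place of heredity of S_xi, and admits the empty
    sequence as a starting point. *)
Definition branch (s : seq wfun) : Prop :=
  forall i, (i < size s)%N -> TT (take i.+1 s).

Definition next_weight (s : seq wfun) : nat :=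
  if s is [::] then m 1 else sigma s.

Lemma branch_full s : branch s -> s <> [::] -> TT s.
Proof. by move=> bs s0; apply: Ttilde_full => //; case: (s) s0. Qed.

Lemma next_weight_index s : branch s ->
  exists j, (0 < j)%N /\ next_weight s = m j.
Proof.
case: s => [_|x s bs]; first by exists 1%N.
have /(Ttilde_special hmn) sp := branch_full bs (fun h =>
  ltac:(discriminate h)).
by have [j j0 e] := coding_range hsigma sp; exists j.
Qed.

Lemma is_min_inj E p q : is_min E p -> is_min E q -> p = q.
Proof.
move=> [Ep pm] [Eq qm]; apply: val_inj; apply/eqP.
by rewrite eqn_leq; apply/andP; split; [exact: pm | exact: qm].
Qed.

Lemma minima_rcons s g w p : is_min (supp g) p ->
  minima (rcons s (g, w)) = minima s `|` [set p].
Proof.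
move=> gp; rewrite seteqP; split=> q.
  move=> [i]; rewrite size_rcons ltnS leq_eqVlt => /orP[/eqP->|si].
    by rewrite /entry nth_rcons ltnn eqxx /= => /is_min_inj/(_ gp) ->; right.
  by rewrite -cats1 entry_cat // => h; left; exists i.
case=> [[i si h]|->].
  by exists i; [rewrite size_rcons ltnW | rewrite -cats1 entry_cat].
by exists (size s); rewrite ?size_rcons // /entry nth_rcons ltnn eqxx.
Qed.

Lemma branch_rcons s F j p : branch s -> (0 < j)%N -> next_weight s = m j ->
  finite_set F -> is_min F p -> S (cnat (n j)) F ->
  (forall i, (i < size s)%N -> set_lt (supp (entry s i).1) F) ->
  S xi (minima s `|` [set p]) ->
  branch (rcons s (chi F, m j)).
Proof.
move=> bs j0 wj Ffin Fp FS sF SE i.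
rewrite size_rcons ltnS leq_eqVlt => /orP[/eqP->|si]; last first.
  by rewrite -cats1 takel_cat //; exact: bs.
rewrite -(size_rcons s (chi F, m j)) take_size {i}.
have eL i : (i < size s)%N -> entry (rcons s (chi F, m j)) i = entry s i.
  by move=> si; rewrite -cats1 entry_cat.
have eR : entry (rcons s (chi F, m j)) (size s) = (chi F, m j).
  by rewrite /entry nth_rcons ltnn eqxx.
have caseS i : (i < (size s).+1)%N -> i = size s \/ (i < size s)%N.
  by rewrite ltnS leq_eqVlt => /orP[/eqP|]; [left|right].
have supF : supp (chi F) = F := chi_supp F.
split; first by case: (s).
(* The conditions on the first entry are guarded so that the data exist for empty [s] too. The
   condition on the minima is left out, being supplied anew for the longer sequence. *)
have [js [h1 [h2 h2'] [h3 h3' h3''] [h4 h4']]] : exists js : nat -> nat,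
    [/\ (forall i, (i < size s)%N -> (0 < js i)%N /\ (entry s i).2 = m (js i)),
        [/\ (forall i, (i < size s)%N ->
               [/\ sign_valued (entry s i).1, finite_set (supp (entry s i).1) &
                   supp (entry s i).1 !=set0]) &
            (forall i i', (i < i' < size s)%N ->
               set_lt (supp (entry s i).1) (supp (entry s i').1))],
        [/\ (forall i, (i < size s)%N ->
          S (cnat (n (js i))) (supp (entry s i).1)),
            (0 < size s)%N -> n (js 0%N) = n 1%N &
            (forall i i', (i < i' < size s)%N -> (n (js i) < n (js i'))%N)] &
        ((0 < size s)%N -> (entry s 0).2 = m 1%N) /\
            (forall i, (0 < i < size s)%N -> (entry s i).2 = sigma (take i s))].
  have [->|/eqP s0] := eqVneq s [::].
    exists (fun=> 0%N); split=> //; split=> //;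
    by [move=> i i' /andP[] | move=> i /andP[]].
  have [_ [js [h1 h2 [h3 h3' h3''] [h4 h4'] _]]] := branch_full bs s0.
  by exists js.
(* The new index exceeds the old ones because sigma exceeds the last weight. *)
have jsj i : (i < size s)%N -> (js i < j)%N.
  move=> si; have s0 : s <> [::] by case: (s) si.
  have sp := Ttilde_special hmn (branch_full bs s0).
  have := coding_gt hsigma sp.
  have -> : sigma s = m j by rewrite -wj; case: (s) s0.
  have ie : (m (js i) <= (last wfun0 s).2)%N.
    rewrite -(proj2 (h1 i si)) -nth_last -/(entry s _).
    have : (i <= (size s).-1)%N by rewrite -ltnS prednK // (leq_ltn_trans _ si).
    rewrite leq_eqVlt => /orP[/eqP-> //|lt]; apply: ltnW.
    have [_ _] := sp; apply; rewrite lt /=.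
    by rewrite prednK // (leq_ltn_trans _ si).
  move=> /(leq_ltn_trans ie); apply: contraTT; rewrite -!leqNgt.
  exact: weights_m_le hmn _ _.
exists (fun i => if (i < size s)%N then js i else j); split.
- move=> i; rewrite size_rcons => /caseS[->|si]; first by rewrite ltnn eR.
  by rewrite si eL //; exact: h1.
- split=> [i|i i' /andP[ii']]; rewrite size_rcons => /caseS[i's|si].
  + rewrite i's eR supF; split=> //; first exact: chi_sign.
    by exists p; case: Fp.
  + by rewrite eL //; exact: h2.
  + rewrite i's eR supF; rewrite i's in ii'; rewrite eL //; exact: sF.
  + by rewrite !eL ?(ltn_trans ii') //; apply: h2'; rewrite ii'.
- split=> [i||i i' /andP[ii']]; rewrite ?size_rcons.
  + move=> /caseS[->|si]; first by rewrite ltnn eR supF.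
    by rewrite si eL //; exact: h3.
  + case: ifP => [/h3' //|]; case: (s) wj => // wj _.
    by rewrite (weights_m_inj hmn wj).
  + move=> /caseS[i's|si]; last first.
      by rewrite si (ltn_trans ii') //; apply: h3''; rewrite ii'.
    rewrite i's in ii'; rewrite ii' i's ltnn.
    by apply: (weights_n_incr hmn); exact: jsj.
- split=> [|i]; rewrite ?size_rcons.
    case: (posnP (size s)) => [/size0nil s0|s0]; last by rewrite eL //;
      exact: h4.
    by rewrite s0 /entry /= -wj s0.
  move=> /andP[i0 /caseS[i_s|si]]; last first.
    by rewrite eL // -cats1 takel_cat ?h4' ?i0 // ltnW.
  rewrite i_s eR -cats1 take_size_cat //= -wj.
  by rewrite i_s in i0; case: (s) i0.
- by rewrite -/(minima _) (@minima_rcons s _ _ p) // supF.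
Qed.

End Extension.

(** * Bounded sequences modulo a subspace of finite codimension *)

Section Pigeonhole.
Context (R : realType) (V : completeNormedModType R).
Local Open Scope ring_scope.

Lemma infinite_close (A : set posnat) (f : posnat -> R) (K eta : R) :
  infinite_set A -> 0 < eta -> (forall p, A p -> `|f p| <= K) ->
  exists A', [/\ A' `<=` A, infinite_set A' &
    forall p p', A' p -> A' p' -> `|f p - f p'| <= eta].
Proof.
move=> Ainf eta0 fK.
(* Cover the range by [N] intervals of length [eta]: either the first one contains infinitely many
   values, or it is discarded together with finitely many points. *)
suff h N a (D : set posnat) : infinite_set D ->
    (forall p, D p -> a <= f p <= a + eta *+ N) ->
    exists A', [/\ A' `<=` D, infinite_set A' &
      forall p p', A' p -> A' p' -> `|f p - f p'| <= eta].
  have [N hN] : exists N : nat, 2 * K <= eta *+ N.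
    have K0 : 0 <= 2 * K / eta.
      have [p Ap _] := infinite_posnat_ge 0 Ainf.
      by rewrite divr_ge0 ?(ltW eta0) // mulr_ge0 // (le_trans _ (fK p Ap)).
    exists (Num.bound (2 * K / eta)); rewrite -[leRHS]mulr_natl -ler_pdivrMr //.
    exact: ltW (archi_boundP K0).
  apply: (h N (- K) A Ainf) => p /fK; rewrite ler_norml => /andP[-> fpK] /=.
  move: hN fpK; move: (eta *+ N) => u; lra.
elim: N a D => [|N IH] a D Dinf Df.
  exists D; split=> // p p' /Df h /Df h';
    rewrite !mulr0n !addr0 -!eq_le in h h'.
  by rewrite -(eqP h) -(eqP h') subrr normr0 ltW.
have [fin|inf] := pselect (finite_set (D `&` [set p | f p <= a + eta]));
  last first.
  exists (D `&` [set p | f p <= a + eta]); split;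
    [by move=> p [] | exact: inf | ].
  move=> p p' [/Df/andP[h1 _] /= h2] [/Df/andP[h3 _] /= h4].
  rewrite ler_norml; apply/andP; split; lra.
have [p [Dp np]|A' [A'D A'inf h]] := IH (a + eta) _ (infinite_setD Dinf fin).
  have /andP[_ fp] := Df p Dp; apply/andP; split; last by rewrite -addrA -mulrS.
  by rewrite leNgt; apply/negP => /ltW lt; apply: np.
by exists A'; split=> // p /A'D[].
Qed.

(* Adding the vectors of w to Y one at a time: as long as a new vector is at
   positive distance from the current Y, its coefficients are bounded. *)
Lemma infinite_close_mod (d : nat) (Y : set V) (w : 'I_d -> V)
    (A : set posnat) (z : posnat -> V) (B eps : R) :
  Y 0 -> (forall (a : R) u v, Y u -> Y v -> Y (a *: u + v)) ->
  infinite_set A -> 0 < eps -> (forall p, A p -> `|z p| <= B) ->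
  (forall p, A p -> exists y (a : 'I_d -> R),
     Y y /\ z p = y + \sum_(i < d) a i *: w i) ->
  exists A', [/\ A' `<=` A, infinite_set A' &
    forall p p', A' p -> A' p' -> exists2 y, Y y & `|z p - z p' - y| <= eps].
Proof.
elim: d Y w A eps => [|d IH] Y w A eps Y0 Ylin Ainf eps0 zB zY.
  exists A; split=> // p p' /zY[y [a [Yy ->]]] /zY[y' [a' [Yy' ->]]].
  exists (-1 *: y' + y); first exact: Ylin.
  by rewrite !big_ord0 !addr0 scaleN1r [- y' + y]addrC subrr normr0 ltW.
pose v := w ord_max.
pose Y' := [set x | exists y (a : R), Y y /\ x = y + a *: v].
have eps3 : 0 < eps / 3 by rewrite divr_gt0.
have [|||||| A1 [A1A A1inf hA1]] :=
    IH Y' (fun i => w (widen_ord (leqnSn d) i)) A (eps / 3) => //.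
- by exists 0, 0; rewrite scale0r addr0.
- move=> a _ _ [y [b [Yy ->]]] [y' [b' [Yy' ->]]].
  exists (a *: y + y'), (a * b + b'); split; first exact: Ylin.
  by rewrite scalerDr scalerA scalerDl addrACA.
- move=> p /zY[y [a [Yy ->]]].
  exists (y + a ord_max *: v), (fun i => a (widen_ord (leqnSn d) i)).
  split; first by exists y, (a ord_max).
  by rewrite big_ord_recr /= -/v addrAC addrA.
have [[dl dl0 hdl]|far] := pselect (exists2 dl : R, 0 < dl &
    forall y, Y y -> dl <= `|v - y|); last first.
  (* Here [v] is a limit of points of [Y], so [a *: v] can be exchanged for a point of [Y] with an
     error of eps / 3. *)
  exists A1; split=> // p p' Ap Ap'.
  have [_ [y [a [Yy ->]]] le] := hA1 p p' Ap Ap'.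
  have a1 : 0 < `|a| + 1 by rewrite ltr_wpDl.
  have [y' Yy' ley'] : exists2 y', Y y' & `|v - y'| < eps / 3 / (`|a| + 1).
    apply: contrapT => h; apply: far; exists (eps / 3 / (`|a| + 1));
      first exact: divr_gt0.
    by move=> y' Yy'; rewrite leNgt; apply/negP => lt; apply: h; exists y'.
  exists (a *: y' + y); first exact: Ylin.
  have -> : z p - z p' - (a *: y' + y) = (z p - z p' - (y + a *: v)) + a *: (v
    - y').
    by rewrite scalerBr !opprD !addrA subrK addrAC.
  apply: le_trans (ler_normD _ _) _; rewrite normrZ.
  have : `|a| * `|v - y'| <= eps / 3.
    apply: (@le_trans _ _ (`|a| * (eps / 3 / (`|a| + 1)))).
      by rewrite ler_wpM2l // ltW.
    rewrite mulrCA ler_piMr ?ltW // ltr_pdivrMr // mul1r ltrDl //.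
  move: le; lra.
(* Only differences of the [z p] are known to be close to [Y'], so the coefficient of [v] is read
   off from [z p - z p0] with [p0] fixed. *)
have [p0 Ap0 _] := infinite_posnat_ge 0 A1inf.
have /choice[f hf] : forall p, exists a : R, A1 p ->
    exists2 y, Y y & `|z p - z p0 - (y + a *: v)| <= eps / 3.
  move=> p; have [Ap|nA] := pselect (A1 p); last by exists 0.
  by have [_ [y [a [Yy ->]]] le] := hA1 p p0 Ap Ap0; exists a => _; exists y.
have fK p : A1 p -> `|f p| <= (2 * B + eps / 3) / dl.
  move=> Ap; have [y Yy le] := hf p Ap; rewrite ler_pdivlMr //.
  have [->|fp] := eqVneq (f p) 0.
    rewrite normr0 mul0r addr_ge0 ?(ltW eps3) // mulr_ge0 //.
    exact: le_trans (zB p (A1A p Ap)).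
  apply: (@le_trans _ _ `|y + f p *: v|).
    have -> : y + f p *: v = f p *: (v - (- (f p)^-1 *: y + 0)).
      by rewrite addr0 scalerBr scaleNr scalerN opprK scalerA mulfV // scale1r
        addrC.
    by rewrite normrZ ler_wpM2l //; apply: hdl; exact: Ylin.
  have -> : y + f p *: v = z p - z p0 - (z p - z p0 - (y + f p *: v)).
    by rewrite opprB [RHS]addrC subrK.
  have := ler_normB (z p - z p0) (z p - z p0 - (y + f p *: v)).
  have := ler_normB (z p) (z p0).
  have := zB p (A1A p Ap); have := zB p0 (A1A p0 Ap0); move: le; lra.
have w0 : 0 < `|v| + 1 by rewrite ltr_wpDl.
have [|A2 [A21 A2inf hA2]] := @infinite_close A1 f _ (eps / 3 / (`|v| + 1))
  A1inf _ fK.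
  exact: divr_gt0.
exists A2; split=> //; first by move=> p /A21/A1A.
move=> p p' Ap Ap'; have [y Yy le] := hf p (A21 p Ap);
  have [y' Yy' le'] := hf p' (A21 p' Ap').
exists (-1 *: y' + y); first exact: Ylin.
have -> : z p - z p' - (-1 *: y' + y) =
    (z p - z p0 - (y + f p *: v)) - (z p' - z p0 - (y' + f p' *: v)) + (f p - f
      p') *: v.
  rewrite scaleN1r scalerBl; move: (f p *: v) (f p' *: v) => s t.
  rewrite (opprB (z p' - z p0)) [y' + t - _]addrC [X in _ = X + _]addrACA [- (y
    + s) + _]addrC -(opprB (y + s)).
  rewrite (opprB (z p')) [z p - z p0 + _]addrA subrK (opprD y' t) [y + s +
    _]addrACA (opprD (y - y')).
  by rewrite [_ + (- (y - y') - _)]addrA subrK [- y' + y]addrC.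
apply: le_trans (ler_normD _ _) _; rewrite normrZ.
have := ler_normB (z p - z p0 - (y + f p *: v)) (z p' - z p0 - (y' + f p' *:
  v)).
have : `|f p - f p'| * `|v| <= eps / 3.
  apply: le_trans (ler_wpM2r _ (hA2 p p' Ap Ap')) _ => //.
  rewrite mulrAC ler_pdivrMr // ler_pM2l // lerDl //.
move: le le'; lra.
Qed.

End Pigeonhole.

(** * The tree of vectors *)

(** A countable family, cofinal among the predecessors of [b], numbered so that a natural number can
    name the next label. At a supremum the number codes a pair; numbers that code none get a default
    pair, which cannot spoil cofinality. *)
Fixpoint pre (b : cord) (k : nat) : option cord :=
  match b with
  | CZ => None
  | CS b' => Some b'
  | CL f => let ij := odflt (0%N, 0%N) (unpickle k) in pre (f ij.1) ij.2
  end.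

Lemma pre_lt b k b' : pre b k = Some b' -> clt b' b.
Proof.
elim: b k => [//|b _ k [<-]|f IH k /= /IH h]; first exact: cle_refl.
exact: cle_CLr h.
Qed.

Lemma pre_cofinal c b : clt c b -> exists k b', pre b k = Some b' /\ cle c b'.
Proof.
elim: b => [//|b _ cb|f IH [i /IH[k [b' [kb cb]]]]]; first by exists 0%N, b.
by exists (pickle (i, k)), b'; rewrite /= pickleK.
Qed.

Lemma game_pre F b E k b' : game F b E -> pre b k = Some b' ->
  exists P : nat, forall p : posnat, (P <= p)%N -> game F b' (E `|` [set p]).
Proof.
elim: b k => [//|b _ k [_ [P hP]] [<-]|f IH k /= h /IH]; first by exists P.
by apply; exact: h.
Qed.

(* In an enumeration of M, the i-th point gets as code the exponent of 2 in
   i.+1. *)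
Lemma infinite_coding (M : set posnat) : infinite_set M ->
  exists code : posnat -> nat, forall k P : nat,
    exists p : posnat, [/\ M p, (P <= p)%N & code p = k].
Proof.
move=> Minf; have /choice[nx hnx] : forall N : nat, exists p,
  M p /\ (N <= pval p)%N.
  by move=> N; have [p Mp Np] := infinite_posnat_ge N Minf; exists p.
pose g := fix g i := if i is i'.+1 then nx (pval (g i')).+1 else nx 0%N.
have gM i : M (g i) by case: i => [|i]; apply: (proj1 (hnx _)).
have glt i : (pval (g i) < pval (g i.+1))%N by have [_] := hnx (pval (g i)).+1.
have gmono i j : (i < j)%N -> (pval (g i) < pval (g j))%N.
  elim: j => // j IH; rewrite ltnS leq_eqVlt => /orP[/eqP-> //|/IH h].
  exact: ltn_trans h (glt j).
have gge i : (i <= pval (g i))%N.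
  by elim: i => // i IH; exact: leq_ltn_trans IH (glt i).
have ginj i j : g i = g j -> i = j.
  by move=> e; case: (ltngtP i j) => // /gmono; rewrite e ltnn.
have /choice[code hcode] : forall p, exists k, forall i, g i = p ->
  k = logn 2 i.+1.
  move=> p; have [[i <-]|h] := pselect (exists i, g i = p).
    by exists (logn 2 i.+1) => j /ginj->.
  by exists 0%N => i gi; exfalso; apply: h; exists i.
exists code => k P; pose i := (2 ^ k * P.*2.+1)%N.
have i0 : (0 < i)%N by rewrite muln_gt0 expn_gt0.
exists (g i.-1); split=> //.
  apply: leq_trans (gge _); rewrite -ltnS prednK // /i.
  apply: (@leq_trans P.*2.+1); first by rewrite ltnS -addnn leq_addr.
  by rewrite leq_pmull ?expn_gt0.
rewrite (hcode _ i.-1 erefl) prednK // /i lognM ?expn_gt0 // pfactorK //.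
by rewrite logn_coprime ?addn0 // coprime2n /= odd_double.
Qed.

Section Branches.
Context (R : realType) (lad : cord -> posnat -> cord) (hlad : is_ladder lad)
  (m n : nat -> nat) (hmn : is_weights R m n)
  (sigma : seq wfun -> nat) (hsigma : is_coding m sigma) (xi : cord)
  (M : set posnat) (hM : infinite_set M).
Local Open Scope ring_scope.
Local Notation S := (schreier lad).

Record average (j : nat) (p : posnat) (c : posnat -> R) (B : nat) : Prop :=
  Average {
    average_block : block M p B 1 c;
    average_schreier : S (cnat (n j)) (supp c);
    average_small : forall K E, S (cnat (n j).-1) E ->
      mass K E c <= 1 / (m j)%:R ^+ 2
  }.

(** Fixing one average for each [j] and [p] makes a node a function of its list of minima. *)
Lemma averages_exist : exists (P : nat -> nat)
    (c : nat -> posnat -> posnat -> R) (B : nat -> posnat -> nat),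
  forall j p, M p -> (P j <= pval p)%N -> average j p (c j p) (B j p).
Proof.
have mj0 j : 0 < 1 / (m j)%:R ^+ 2 :> R.
  by rewrite divr_gt0 // exprn_gt0 // ltr0n (weights_m_gt0 hmn).
have nj0 j : (0 < n j)%N.
  by apply: leq_trans (weights_n_le hmn (leq0n j)); rewrite (weights_n0 hmn).
have /choice[P hP] : forall j, exists P : nat, forall p : posnat, exists cB,
    M p -> (P <= p)%N -> average j p cB.1 cB.2.
  move=> j; have [P hP] := averages hlad (n j).-1 hM (mj0 j); exists P => p.
  have [[Mp Pp]|nh] := pselect (M p /\ (P <= p)%N); last first.
    by exists (fun=> 0, 0%N) => Mp Pp; exfalso; apply: nh.
  by have [c [B]] := hP p Mp Pp; rewrite prednK // => -[h1 h2 h3];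
    exists (c, B).
have /choice[cB hcB] : forall j, exists cB : posnat -> (posnat -> R) * nat,
    forall p, M p -> (P j <= pval p)%N -> average j p (cB p).1 (cB p).2.
  by move=> j; have /choice[f hf] := hP j; exists f.
by exists P, (fun j p => (cB j p).1), (fun j p => (cB j p).2) => j p;
  exact: hcB.
Qed.

Lemma branch_supp_bound s : branch lad m n sigma xi s ->
  exists L : nat, forall i, (i < size s)%N ->
    forall q, supp (entry s i).1 q -> (q < L)%N.
Proof.
move=> br.
have /choice[f hf] : forall i, exists L : nat, (i < size s)%N ->
    forall q, supp (entry s i).1 q -> (q < L)%N.
  move=> i; have [si|] := ltnP i (size s); last by exists 0%N.
  have s0 : s <> [::] by case: (s) si.
  have [_ [js [_ [h _] _ _ _]]] := branch_full br s0.
  by have [_ /finite_pbounded[L hL] _] := h i si; exists L => _.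
exists (\max_(i < size s) f i) => i si q gq.
by apply: leq_trans (hf i si q gq) _; exact: (leq_bigmax (Ordinal si)).
Qed.

Definition next_index (s : seq wfun) : nat :=
  xget 1%N [set j | (0 < j)%N /\ next_weight m sigma s = m j].

Lemma next_indexP s : branch lad m n sigma xi s ->
  (0 < next_index s)%N /\ next_weight m sigma s = m (next_index s).
Proof. by move=> bs; apply: (xgetPex 1%N (next_weight_index hmn hsigma bs)).
  Qed.

Definition scaled (j : nat) (c : posnat -> R) : posnat -> R :=
  fun q => (m j)%:R * c q.

Lemma scaled_supp j c : supp (scaled j c) = supp c.
Proof.
rewrite seteqP; split=> q; rewrite /supp /scaled /= mulf_eq0 negb_or.
  by case/andP.
by rewrite pnatr_eq0 -lt0n (weights_m_gt0 hmn).
Qed.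

Lemma average_abs j p c B K E : average j p c B ->
  mass K E (fun q => `|c q|) = mass K E c.
Proof.
by move=> [[c0 _ _ _ _] _ _]; apply: eq_bigr => i _; rewrite ger0_norm.
Qed.

Lemma average_finite j p c B : average j p c B -> finite_set (supp c).
Proof.
move=> av; apply: pbounded_finite; exists B.+1 => q.
by rewrite ltnS; exact: block_supp_le (average_block av).
Qed.

Context (Pv : nat -> nat) (cv : nat -> posnat -> posnat -> R)
  (Bv : nat -> posnat -> nat)
  (hcv : forall j p, M p -> (Pv j <= pval p)%N -> average j p (cv j p) (Bv j p))
  (code : posnat -> nat) (hcode : forall k P : nat,
    exists p : posnat, [/\ M p, (P <= p)%N & code p = k]).

(* A node is described by the list of the minima of its vectors, the last one
   coming first; this determines the pairs and the vectors of the node, and an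
   ordinal label that decreases along the branches. *)
Fixpoint pairs (r : seq posnat) : seq wfun :=
  if r is p :: r' then
    let j := next_index (pairs r') in
    rcons (pairs r') (chi (supp (cv j p)), m j)
  else [::].

Fixpoint vectors (r : seq posnat) : seq (posnat -> R) :=
  if r is p :: r' then
    let j := next_index (pairs r') in rcons (vectors r') (scaled j (cv j p))
  else [::].

Fixpoint label (r : seq posnat) : cord :=
  if r is p :: r' then odflt CZ (pre (label r') (code p)) else omega_pow xi.

(** The game condition guarantees that as many points as the label says can still be added to the
    minima within S_xi. As labels also decrease strictly along branches, they bound the rank from
    both sides. *)
Fixpoint legal (r : seq posnat) : Prop :=
  if r is p :: r' then
    [/\ legal r', M p /\ (Pv (next_index (pairs r')) <= p)%N,
        forall i, (i < size (pairs r'))%N ->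
          forall q, supp (entry (pairs r') i).1 q -> (q < p)%N &
        exists2 b, pre (label r') (code p) = Some b &
          game (S xi) b (minima (pairs r') `|` [set p])]
  else True.

Lemma size_pairs r : size (pairs r) = size r.
Proof. by elim: r => //= p r IH; rewrite size_rcons IH. Qed.

Lemma size_vectors r : size (vectors r) = size r.
Proof. by elim: r => //= p r IH; rewrite size_rcons IH. Qed.

Lemma legal_branch r : legal r ->
  branch lad m n sigma xi (pairs r) /\ game (S xi) (label r) (minima (pairs r)).
Proof.
elim: r => [_|p r IH /= [lr [Mp Pp] lt [b pb gb]]].
  split=> //=; suff -> : minima [::] = set0 by exact: game_schreier.
  by rewrite seteqP; split=> q // [].
have [br gr] := IH lr; have [j0 wj] := next_indexP br.
have av := hcv Mp Pp; have minp := block_min (average_block av).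
split.
  apply: (branch_rcons hmn hsigma br j0 wj _ minp) => //.
  - exact: average_finite av.
  - exact: average_schreier av.
  - move=> i si q q' gq cq'; apply: leq_trans (lt i si q gq) _.
    by apply: (proj2 minp).
  - exact: game_in gb.
by rewrite (@minima_rcons _ _ _ p) ?chi_supp // pb.
Qed.

(** [pre] is cofinal and every value of [code] occurs at arbitrarily large points of [M], so the
    point naming a suitable predecessor can be taken beyond all other thresholds. *)
Lemma legal_extend r c : legal r -> clt c (label r) ->
  forall P : nat, exists p, [/\ (P <= pval p)%N,
    legal (p :: r) & cle c (label (p :: r))].
Proof.
move=> lr cl P; have [br gr] := legal_branch lr.
have [k [b [kb cb]]] := pre_cofinal cl.
have [N hN] := game_pre gr kb.
have [L hL] := branch_supp_bound br.
have [p [Mp]] := hcode k (maxn (maxn P N) (maxn L (Pv (next_index (pairs r))))).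
rewrite !geq_max => /andP[/andP[Pp Np] /andP[Lp Qp]] ck.
exists p; split=> //; last by rewrite /= ck kb.
split=> //; last by exists b; [rewrite ck | exact: hN].
by move=> i si q gq; exact: leq_trans (hL i si q gq) Lp.
Qed.

Lemma legal_suffix w r : legal (w ++ r) -> legal r.
Proof. by elim: w => //= p w IH [/IH]. Qed.

Lemma label_lt w r : w <> [::] -> legal (w ++ r) ->
  clt (label (w ++ r)) (label r).
Proof.
elim: w => // p w IH _ /= [lw _ _ [b pb _]]; rewrite pb.
apply: clt_le_trans (pre_lt pb) _.
case: w IH lw {pb} => [_ _|q w IH lw]; first exact: cle_refl.
by apply: clt_le; exact: IH.
Qed.

Lemma legal_entry r i : legal r -> (i < size r)%N -> exists j p c B,
  [/\ (0 < j)%N, average j p c B, entry (pairs r) i = (chi (supp c), m j),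
      nth 0 (vectors r) i = scaled j c & nth p (rev r) i = p].
Proof.
elim: r => // p r IH lpr; have [lr [Mp Pp] _ _] := lpr.
have [/next_indexP[j0 _] _] := legal_branch lr.
rewrite /= ltnS leq_eqVlt rev_cons /entry !nth_rcons size_pairs size_vectors.
move=> /orP[/eqP->|ir].
  exists (next_index (pairs r)), p, (cv (next_index (pairs r)) p),
    (Bv (next_index (pairs r)) p).
  by rewrite ltnn eqxx nth_rcons size_rev ltnn eqxx; split=> //; exact: hcv.
rewrite ir; have [j [q [c [B [h1 h2 h3 h4 h5]]]]] := IH lr ir.
by exists j, q, c, B; split=> //; rewrite nth_rcons size_rev ir.
Qed.

Definition least (x : posnat ->
  R) : posnat := xget (pos 0) [set p | is_min (supp x) p].

(** The minima, and with them the whole node, can be read off from the vectors; so initial segments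
    in [vector_tree] come from suffixes of lists of minima. *)
Lemma map_least r : legal r -> map least (vectors r) = rev r.
Proof.
move=> lr; apply: (@eq_from_nth _ (pos 0));
  rewrite ?size_map ?size_vectors ?size_rev //.
move=> i ir; have [j [p [c [B [_ av _ vi pi]]]]] := legal_entry lr ir.
rewrite (nth_map 0) ?size_vectors // vi (set_nth_default p) ?size_rev // pi.
have cp : is_min (supp (scaled j c)) p.
  by rewrite scaled_supp; exact: block_min (average_block av).
by apply: (is_min_inj _ cp); apply: (xgetPex (pos 0)); exists p.
Qed.

Lemma vectors_cat w r : exists2 u,
  vectors (w ++ r) = vectors r ++ u & size u = size w.
Proof.
elim: w => [|p w [u e su]]; first by exists [::]; rewrite ?cats0.
by exists (rcons u (scaled (next_index (pairs (w ++ r))) (cv (next_index (pairs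
  (w ++ r))) p)));
  rewrite /= ?size_rcons ?su // e rcons_cat.
Qed.

Lemma vectors_prefix r r' u : legal r -> legal r' ->
  vectors r' = vectors r ++ u -> r' = rev (map least u) ++ r.
Proof.
move=> lr lr' e; apply: (can_inj revK).
by rewrite -(map_least lr') e map_cat (map_least lr) rev_cat revK.
Qed.

Definition vector_tree : set (seq (posnat -> R)) :=
  [set v | exists r, [/\ legal r, r <> [::] & v = vectors r]].

Lemma vector_tree_prefix r v : legal r -> vector_tree v ->
  initial_lt (vectors r) v -> exists2 r', legal r' &
    [/\ r' <> [::], v = vectors r' & clt (label r') (label r)].
Proof.
move=> lr [r' [lr' r'0 ->]] [u [u0 e]]; exists r' => //; split=> //.
have e' := vectors_prefix lr lr' e.
rewrite e' in lr' *; apply: label_lt lr' => /(congr1 size).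
by rewrite size_rev size_map; case: (u) u0.
Qed.

Lemma vector_tree_wf : well_founded_tree vector_tree.
Proof.
move=> v; constructor=> v' [_ [r [lr _ ->]] _] {v v'}.
have [b] := ex_intro (fun b => b = label r) _ erefl.
elim/(well_founded_ind clt_wf): b r lr => b IH r lr br.
constructor=> v [_ Tv lt].
have [r' lr' [_ -> ltl]] := vector_tree_prefix lr Tv lt.
by apply: (IH (label r')) => //; rewrite br.
Qed.

Lemma derived_iter_sub (A : Type) (T : set (seq A)) b : derived_iter T b `<=` T.
Proof. by elim: b => [|b IH|f IH] s //=;
  [case=> /IH | move=> /(_ 0%N I)/IH]. Qed.

Lemma derived_label r b : legal r -> derived_iter vector_tree b (vectors r) ->
  cle b (label r).
Proof.
elim: b r => [//|b IH|f IH] r lr.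
  move=> [_ [v Tv lt]].
  have [r' lr' [_ e ltl]] := vector_tree_prefix lr (derived_iter_sub Tv) lt.
  by apply: cle_lt_trans ltl; apply: IH => //; rewrite -e.
by move=> h k; apply: IH => //; exact: h.
Qed.

Lemma initial_lt_vectors p r : initial_lt (vectors r) (vectors (p :: r)).
Proof. by rewrite /= -cats1; eexists; split; last reflexivity. Qed.

Lemma label_derived r b : legal r -> r <> [::] -> cle b (label r) ->
  derived_iter vector_tree b (vectors r).
Proof.
elim: b r => [|b IH|f IH] r lr r0 bl; first by exists r.
  split; first by apply: IH => //; exact: clt_le.
  have [p [_ lp cp]] := legal_extend lr bl 0.
  by exists (vectors (p :: r)); [exact: IH | exact: initial_lt_vectors].
by move=> k _; exact: IH.
Qed.

(** The empty list carries the label omega^xi but is not a node; nodes have smaller labels, which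
    makes the derived tree of order omega^xi empty, while [legal_extend] from the empty list attains
    every smaller order. *)
Lemma vector_tree_height : has_height vector_tree (omega_pow xi).
Proof.
split.
  apply/eqP; apply: contrapT => /negP/set0P[v Tv].
  have [r [lr r0 e]] := derived_iter_sub Tv; rewrite e in Tv.
  have := derived_label lr Tv; rewrite -[r]cats0 in lr *.
  by move=> /(clt_le_trans (label_lt r0 lr)); exact: clt_irrefl.
move=> b blt; have [p [_ lp cp]] := @legal_extend [::] b I blt 0.
by apply/eqP/set0P; exists (vectors [:: p]); exact: label_derived.
Qed.

Lemma vector_tree_branching v : derived vector_tree v ->
  infinite_set [set x | vector_tree (rcons v x)].
Proof.
move=> [[r [lr r0 ->]] [v' Tv' lt]] fin.
have [r' lr' [_ _ ltl]] := vector_tree_prefix lr Tv' lt.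
have fl := finite_image least fin.
have [N hN] := finite_pbounded fl.
have [p [Np lp _]] := legal_extend lr ltl N.
suff /hN : (least @` [set x | vector_tree (rcons (vectors r) x)]) p by rewrite
  ltnNge Np.
exists (scaled (next_index (pairs r)) (cv (next_index (pairs r)) p)).
  by exists (p :: r).
have := map_least lp; rewrite /= map_rcons rev_cons (map_least lr).
by move=> /rcons_inj[].
Qed.

Lemma vector_tree_closed s u : s <> [::] -> vector_tree (s ++ u) ->
  vector_tree s.
Proof.
move=> s0 [r [lr r0 e]].
have sr : size r = (size s + size u)%N by rewrite -size_vectors -e size_cat.
(* Lists begin with the last minimum, so an initial segment of vectors is obtained by dropping from
   the front. *)
exists (drop (size u) r); split.
- by apply: (@legal_suffix (take (size u) r)); rewrite cat_take_drop.
- by move=> /(congr1 size); rewrite size_drop sr addnK; case: (s) s0.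
- move: e; rewrite -{1}(cat_take_drop (size u) r).
  have [w -> sw] := vectors_cat (take (size u) r) (drop (size u) r).
  move=> /(congr1 (take (size s))).
  by rewrite !take_size_cat // size_vectors size_drop sr addnK.
Qed.

Lemma legal_data r : legal r -> exists (js : nat -> nat) (ps : nat -> posnat)
    (cs : nat -> posnat -> R) (Bs : nat -> nat),
  forall i, (i < size r)%N ->
    [/\ (0 < js i)%N, average (js i) (ps i) (cs i) (Bs i),
    entry (pairs r) i = (chi (supp (cs i)), m (js i)) &
    nth 0 (vectors r) i = scaled (js i) (cs i)].
Proof.
move=> lr.
have /choice[d hd] : forall i, exists d : nat * posnat * (posnat -> R) * nat,
    (i < size r)%N -> [/\ (0 < d.1.1.1)%N, average d.1.1.1 d.1.1.2 d.1.2 d.2,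
    entry (pairs r) i = (chi (supp d.1.2), m d.1.1.1) &
    nth 0 (vectors r) i = scaled d.1.1.1 d.1.2].
  move=> i; have [ir|ri] := ltnP i (size r);
    last by exists (0%N, pos 0, fun=> 0, 0%N).
  by have [j [p [c [B [h1 h2 h3 h4 _]]]]] := legal_entry lr ir;
    exists (j, p, c, B).
exists (fun i => (d i).1.1.1), (fun i => (d i).1.1.2), (fun i =>
  (d i).1.2), (fun i => (d i).2).
exact: hd.
Qed.

Lemma legal_supp_lt r i j : legal r -> (i < j < size r)%N ->
  set_lt (supp (entry (pairs r) i).1) (supp (entry (pairs r) j).1).
Proof.
move=> lr ij; have /andP[_ jr] := ij.
have [br _] := legal_branch lr; rewrite -size_pairs in ij jr.
have s0 : pairs r <> [::] by case: (pairs r) jr.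
by have [_ [js [_ [_ h] _ _ _]]] := branch_full br s0; exact: h.
Qed.

Lemma average_sum_chi j p c B K a : average j p c B -> (B <= K)%N ->
  \sum_(i < K) (m j)%:R^-1 * (chi (supp c) (pos i))%:~R * (a * ((m j)%:R * c
    (pos i))) = a.
Proof.
move=> [bl _ _] BK; rewrite -[RHS]mulr1 -[X in _ = _ * X](block_total bl BK)
  mass_total mulr_sumr.
apply: eq_bigr => i _; rewrite /chi /supp /=.
have mj0 : (m j)%:R != 0 :> R by rewrite pnatr_eq0 -lt0n (weights_m_gt0 hmn).
case: asboolP => [_|/negP/negPn/eqP->]; last by rewrite !mulr0.
by rewrite mulr1 mulrCA mulKf.
Qed.

Context (X : completeNormedModType R) (e : posnat -> X)
  (hX : is_completion (normW lad m n sigma xi) e).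

(** For the lower estimate, the leaf functional of the i-th pair takes the value a_i on the sum, the
    supports being disjoint. The upper one is [norm_upper_bound] with A = 1. *)
Lemma vectors_equiv r : legal r ->
  equiv_c0 3 (size r) (fun i => lincomb e (nth 0 (vectors r) i)).
Proof.
move=> lr a; have [js [ps [cs [Bs hd]]]] := legal_data lr.
have [br _] := legal_branch lr; have sr := size_pairs r.
set N := `|_|; set mx := \big[_/_]_(_ < _) _.
have amx i : (i < size r)%N -> `|a i| <= mx.
  by move=> ir; apply: (le_bigmax _ (fun i : 'I_(size r) =>
    `|a i|) (Ordinal ir)).
have mx0 : 0 <= mx by apply: bigmax_ge_id.
pose K := \max_(i < size r) Bs i.
have BK i : (i < size r)%N -> (Bs i <= K)%N.
  by move=> ir; exact: (leq_bigmax (Ordinal ir)).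
have cK i : (i < size r)%N -> forall q : posnat, (K < q)%N -> cs i q = 0.
  move=> ir q Kq; have [_ [bl _ _] _ _] := hd i ir; apply: (block_bound bl).
  exact: leq_ltn_trans (BK i ir) Kq.
have NE : N = `|\sum_(i < size r) a i *: lincomb e (scaled (js i) (cs i))|.
  by congr `|_|; apply: eq_bigr => i _; have [_ _ _ ->] := hd i (ltn_ord i).
apply/andP; split.
  apply: (@le_trans _ _ mx);
    first by rewrite ler_piMl // invf_le1 ?ltr0n // ler1n.
  apply: bigmax_le; first exact: normr_ge0.
  move=> i _; have ir := ltn_ord i; have [j0 av ei _] := hd i ir.
  rewrite NE (@lincomb_sum R X e (size r) a (fun i => scaled (js i) (cs i)) K);
    last first.
    by move=> l ls q Kq; rewrite /scaled cK ?mulr0.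
  have lasti : last wfun0 (take i.+1 (pairs r)) = (chi (supp (cs i)), m (js i)).
    by rewrite take_entry ?sr // last_rcons.
  have Ti : Ttilde lad m n sigma xi (take i.+1 (pairs r)) by apply: br;
    rewrite sr.
  have := @norm_leaf _ _ _ _ hmn _ _ _ e hX _ _ _
    (fun q => \sum_(l < size r) a l * scaled (js l) (cs l) q) K Ti lasti.
  have -> : \sum_(t < K) (m (js i))%:R^-1 * (chi (supp (cs i)) (pos t))%:~R *
      (\sum_(l < size r) a l * scaled (js l) (cs l) (pos t)) = a i.
    rewrite -[RHS](average_sum_chi (a i) av (BK i ir)).
    apply: eq_bigr => t _; rewrite (bigD1 i) //= mulrDr [X in _ + X](_ : _ = 0)
      ?addr0 //.
    have [it|it] := pselect (supp (cs i) (pos t)); last first.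
      by rewrite /chi; case: asboolP => // _; rewrite mulr0 mul0r.
    rewrite big1 ?mulr0 // => l li; rewrite /scaled.
    have [->|lt] := eqVneq (cs l (pos t)) 0; first by rewrite !mulr0.
    have lr' := ltn_ord l; have [_ _ el _] := hd l lr'.
    exfalso; case: (ltngtP i l) => il; last by move/eqP: li; apply;
      apply: val_inj.
    + have := @legal_supp_lt r i l lr; rewrite il lr' ei el /= !chi_supp.
      by move=> /(_ isT _ _ it lt); rewrite ltnn.
    + have := @legal_supp_lt r l i lr; rewrite il ir ei el /= !chi_supp.
      by move=> /(_ isT _ _ lt it); rewrite ltnn.
  by apply => q Kq; rewrite big1 // => l _; rewrite /scaled cK ?mulr0.
have U := @norm_upper_bound _ _ _ _ hmn _ hsigma _ _ _ hX (pairs r) K cs a 1 mx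
  js.
rewrite sr mulr1 in U; rewrite NE; apply: U => //.
- by move=> i ir; apply: br; rewrite sr.
- by move=> i ir; have [j0 _ -> _] := hd i ir.
- move=> i ir; have [_ av _ _] := hd i ir.
  rewrite (average_abs _ _ av); exact: block_mass_le (average_block av).
- move=> i ir E SE; have [_ av _ _] := hd i ir.
  rewrite (average_abs _ _ av); exact: average_small av _ _ SE.
- by move=> i ir q cq; have [_ _ -> _] := hd i ir; exists q;
  rewrite //= chi_supp.
Qed.

Lemma vector_tree_c0 : c0_tree e M (omega_pow xi) vector_tree.
Proof.
split.
- by move=> s [r [_ r0 ->]] /(congr1 size); rewrite size_vectors; case: (r) r0.
- move=> s i [r [lr _ ->]]; rewrite size_vectors => ir.
  have [j [p [c [B [_ av _ -> _]]]]] := legal_entry lr ir.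
  by rewrite /c00 /= scaled_supp; exact: average_finite av.
- move=> s i [r [lr _ ->]]; rewrite size_vectors => ir.
  have [j [p [c [B [_ [bl _ _] _ -> _]]]]] := legal_entry lr ir.
  by rewrite scaled_supp; exact: block_sub bl.
- move=> s i j [r [lr _ ->]]; rewrite size_vectors => ij.
  have /andP[ij' jr] := ij; have ir := ltn_trans ij' jr.
  have := legal_supp_lt lr ij.
  have [? [? [c [? [_ _ -> -> _]]]]] := legal_entry lr ir.
  have [? [? [c' [? [_ _ -> -> _]]]]] := legal_entry lr jr.
  by rewrite !scaled_supp /= !chi_supp.
- exact: vector_tree_closed.
- exact: vector_tree_wf.
- exact: vector_tree_height.
- exact: vector_tree_branching.
- exists 3; split=> // s [r [lr _ ->]]; rewrite size_vectors;
  exact: vectors_equiv.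
Qed.

(** * The game *)

(* One turn of the game: x is the vector played, t the pair recorded for it, and
   m_j c is a vector of which x is almost the multiple by b. *)
Record turn (r : R) (t : wfun) (x : X) (j : nat) (c : posnat -> R) (B : nat)
    (b : R) : Prop := Turn {
  turn_index : (0 < j)%N /\ t.2 = m j;
  turn_bound : forall q : posnat, (B < q)%N -> c q = 0;
  turn_mass : forall K, mass K setT (fun q => `|c q|) <= 2;
  turn_small : forall K E, S (cnat (n j).-1) E ->
    mass K E (fun q => `|c q|) <= 2 / (m j)%:R ^+ 2;
  turn_supp : forall q, c q != 0 -> exists2 q', supp t.1 q' & (q <= q')%N;
  turn_scalar : `|b| <= 2;
  turn_norm : `|x| = 1;
  turn_close : `|x - b *: lincomb e (scaled j c)| <= r
}.

Lemma average_norm_le j p c B : average j p c B ->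
  `|lincomb e (scaled j c)| <= (m j)%:R.
Proof.
move=> [bl _ _]; have cB := block_bound bl.
apply: (norm_le hmn hX (K := B)) => [q /cB c0|f Wf].
  by rewrite /scaled c0 mulr0.
have [Y _ df] := W_decomposable Wf.
rewrite -[leRHS]mulr1 -[X in _ * X](block_total bl (leqnn B)) mass_total
  mulr_sumr.
apply: ler_sum => i _; apply: le_trans (ler_norm _) _.
rewrite normrM /scaled [`|_ * c _|]ger0_norm ?mulr_ge0 ?(block_ge0 bl) //.
by rewrite ler_piMl ?mulr_ge0 ?(block_ge0 bl) //;
  exact: (decomposable_le1 hmn _ df).
Qed.

(** The difference v_p - v_p' has norm at least 1, by the leaf of the recorded pair. As [r] is at
    most 1/2, the nearby [y] in [Y] has norm at least 1/2, so normalizing it multiplies by some [b]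
    <= 2 and at most doubles the error. *)
Lemma exists_turn s k (Y : set X) (r : R) :
  branch lad m n sigma xi s -> game (S xi) (cnat k.+1) (minima s) ->
  finite_codim_subspace (closed_span e M) Y -> 0 < r -> r <= 2^-1 ->
  exists t x j c B b, [/\ turn (2 * r) t x j c B b, Y x,
    branch lad m n sigma xi (rcons s t) &
    game (S xi) (cnat k) (minima (rcons s t))].
Proof.
move=> br [_ [N hN]] [[_ Y0 Ylin] YZ [d [w [wZ hw]]]] r0 r12.
have [j0 wj] := next_indexP br; set j := next_index s in j0 wj.
have [L hL] := branch_supp_bound br.
pose A := M `\` [set p : posnat | (p < maxn N (maxn L (Pv j)))%N].
have Ainf : infinite_set A by apply: infinite_setD => //;
  exact: finite_posnat_lt.
have AP p : A p -> [/\ M p, (N <= p)%N, (L <= p)%N & (Pv j <= p)%N].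
  by move=> [Mp /negP]; rewrite -leqNgt !geq_max => /and3P[].
have av p : A p -> average j p (cv j p) (Bv j p).
  by move=> /AP[Mp _ _ Pp]; exact: hcv.
pose v p := lincomb e (scaled j (cv j p)).
have vZ p : A p -> closed_span e M (v p).
  move=> /av Ap; apply: subset_closure; exists (scaled j (cv j p)) => //=.
  rewrite /c00 /= scaled_supp; split; first exact: average_finite Ap.
  exact: block_sub (average_block Ap).
have [A' [A'A A'inf hA']] := infinite_close_mod Y0 Ylin Ainf r0
  (fun p Ap => average_norm_le (av p Ap)) (fun p Ap => hw _ (vZ p Ap)).
have [p Ap _] := infinite_posnat_ge 0 A'inf.
(* Taking [p'] beyond the end of the first average separates the two supports, and the second one
   then bounds both. *)
have [p' Ap' pp'] := infinite_posnat_ge (Bv j p).+1 A'inf.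
have [y Yy le] := hA' p p' Ap Ap'.
have avp := av p (A'A _ Ap); have avp' := av p' (A'A _ Ap').
have [_ Np' Lp' _] := AP p' (A'A _ Ap').
move: (cv j p) (cv j p') (Bv j p) (Bv j p') avp avp' pp' @v {vZ hA'} le =>
  c c' B B' avp avp' pp' /= le.
have blc := average_block avp; have blc' := average_block avp'.
have minp' := block_min blc'.
pose u q := c q - c' q; pose t := (chi (supp c'), m j).
have bt : branch lad m n sigma xi (rcons s t).
  apply: (branch_rcons hmn hsigma br j0 wj (average_finite avp') minp') => //.
  - exact: average_schreier avp'.
  - move=> i si q q' gq cq'; apply: leq_trans (hL i si q gq) _.
    by apply: leq_trans Lp' _; apply: (proj2 minp').
  - exact: game_in (hN p' Np').
have gt : game (S xi) (cnat k) (minima (rcons s t)).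
  by rewrite (@minima_rcons _ _ _ p') ?chi_supp //; exact: hN.
have uB q : (maxn B B' < pval q)%N -> u q = 0.
  rewrite gtn_max => /andP[Bq B'q].
  by rewrite /u (block_bound blc Bq) (block_bound blc' B'q) subrr.
have uE : lincomb e (scaled j u) = lincomb e (scaled j c) - lincomb e (scaled j
  c').
  rewrite -(@lincombB _ _ _ _ _ (maxn B B')).
  - by congr lincomb; apply/funext => q; rewrite /scaled /u mulrBr.
  - by move=> q; rewrite gtn_max /scaled => /andP[/(block_bound blc)-> _];
    rewrite mulr0.
  - by move=> q; rewrite gtn_max /scaled => /andP[_ /(block_bound blc')->];
    rewrite mulr0.
have disj q : supp c' q -> c q = 0.
  move=> c'q; apply: (block_bound blc); apply: leq_trans pp' _.
  exact: (proj2 minp').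
have u1 : 1 <= `|lincomb e (scaled j u)|.
  have Tt : Ttilde lad m n sigma xi (rcons s t).
    by apply: branch_full bt _ => /(congr1 size); rewrite size_rcons.
  have := @norm_leaf _ _ _ _ hmn _ _ _ e hX _ _ _ (scaled j u) (maxn B B') Tt
    (last_rcons _ _ _).
  move=> h; apply: le_trans (h _); last first.
    by move=> q /uB u0; rewrite /scaled u0 mulr0.
  rewrite -[X in X <= _]normr1 -normrN.
  rewrite -(average_sum_chi (- 1) avp' (leq_maxr B B')) le_eqVlt; apply/orP;
    left.
  apply/eqP; congr `|_|; apply: eq_bigr => i _; rewrite /scaled /u.
  have [c'i|c'i] := pselect (supp c' (pos i)); last first.
    by rewrite /chi; case: asboolP => // _; rewrite mulr0 !mul0r.
  by rewrite (disj _ c'i) sub0r mulrN mulN1r.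
have y12 : 2^-1 <= `|y|.
  have := ler_normB (lincomb e (scaled j u) - y) (- y);
    rewrite opprK subrK normrN.
  move: le; rewrite -uE; lra.
have y0 : 0 < `|y| by apply: lt_le_trans y12; rewrite invr_gt0.
have b2 : `|y|^-1 <= 2 by rewrite -[2]invrK lef_pV2 // posrE invr_gt0.
have am K E : mass K E (fun q => `|u q|) <= mass K E c + mass K E c'.
  rewrite -massD; apply: ler_sum => i _; apply: le_trans (ler_normB _ _) _.
  by rewrite !ger0_norm ?(block_ge0 blc) ?(block_ge0 blc').
exists t, (`|y|^-1 *: y), j, u, (maxn B B'), (`|y|^-1); split=> //; last first.
  by rewrite -[_ *: y]addr0; exact: Ylin.
split=> //.
- move=> K; apply: le_trans (am _ _) _.
  have := block_mass_le K setT blc; have := block_mass_le K setT blc'; lra.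
- move=> K E SE; apply: le_trans (am _ _) _.
  rewrite -[2]/(1 + 1) mulrDl.
  by apply: lerD; [exact: average_small avp _ _ SE | exact: average_small avp'
    _ _ SE].
- move=> q uq; rewrite /= chi_supp.
  have [c'q|/negP/negPn/eqP c'q] := pselect (supp c' q); first by exists q.
  exists p'; first by case: minp'.
  apply: ltnW; apply: leq_ltn_trans pp'; apply: (block_supp_le blc).
  by move: uq; rewrite /u c'q subr0.
- by rewrite normrV ?unitfE ?gt_eqF // normr_id.
- by rewrite normrZ normrV ?unitfE ?gt_eqF // normr_id mulVf // gt_eqF.
- rewrite -scalerBr normrZ normrV ?unitfE ?gt_eqF // normr_id distrC uE.
  by apply: ler_pM => //; rewrite invr_ge0.
Qed.

(** Besides the [i] turns played, room for [i'] more is kept in S_xi, and the induction consumes it.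
    At the start any finite amount is available, since xi >= 1 gives omega <= omega^xi. *)
Lemma exists_play (St : seq X -> set X) (r : R) :
  (forall h, finite_codim_subspace (closed_span e M) (St h)) ->
  0 < r -> r <= 2^-1 -> cle (cnat 1) xi ->
  forall i i', exists s (x : nat -> X) (js : nat -> nat) (cs : nat -> posnat ->
    R)
    (Bs : nat -> nat) (b : nat -> R),
  [/\ size s = i, branch lad m n sigma xi s, game (S xi) (cnat i') (minima s) &
    forall l, (l < i)%N -> St (mkseq x l) (x l) /\
      turn (2 * r) (entry s l) (x l) (js l) (cs l) (Bs l) (b l)].
Proof.
move=> hS r0 r12 xi1; elim=> [|i IH] i'.
  exists [::], (fun=> 0), (fun=> 0%N), (fun _ _ => 0), (fun=> 0%N), (fun=> 0);
    split=> //.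
  have -> : minima [::] = set0 by rewrite seteqP; split=> q // [].
  apply: game_le (game_schreier hlad xi).
  exact: cle_trans (omega_pow1 _) (omega_pow_mono xi1).
have [s [x [js [cs [Bs [b [ss br gm hl]]]]]]] := IH i'.+1.
have [t [y [j [c [B [a [tt Sy bt gt]]]]]]] := exists_turn br gm (hS (mkseq x
  i)) r0 r12.
pose upd (T : Type) (f : nat -> T) (z : T) l := if l == i then z else f l.
exists (rcons s t), (upd _ x y), (upd _ js j), (upd _ cs c), (upd _ Bs B),
  (upd _ b a).
split=> //; first by rewrite size_rcons ss.
have updN (T : Type) (f : nat -> T) z l : (l < i)%N -> upd T f z l = f l.
  by move=> li; rewrite /upd ltn_eqF.
have eqm l : (l <= i)%N -> mkseq (upd _ x y) l = mkseq x l.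
  move=> li; apply/eq_in_map => l'; rewrite mem_iota add0n => /andP[_ ll'].
  by rewrite updN // (leq_trans ll').
move=> l; rewrite ltnS leq_eqVlt => /orP[/eqP->|li].
  by rewrite eqm // /upd eqxx /entry nth_rcons ss ltnn eqxx.
by rewrite eqm ?(ltnW li) // !updN // -cats1 entry_cat ?ss //; exact: hl.
Qed.

Lemma not_asymptotic_l1 : cle (cnat 1) xi -> ~ asymptotic_l1 (closed_span e M).
Proof.
move=> xi1 [C [C0 hC]].
(* The sum of the k vectors played has norm at most 13 for every k: k errors of 2 r = 1 / k, plus 3
   A B with masses A = 2 and scalars B = 2. An l_1 estimate with constant C would force at least k /
   C. *)
pose k := (Num.bound (13 * C)).+1.
have kC : 13 * C < k%:R.
  apply: lt_trans (archi_boundP _) _; first by rewrite mulr_ge0 // ltW.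
  by rewrite ltr_nat.
have k0 : 0 < k%:R :> R by rewrite ltr0n.
have [St [hS hE]] := hC k; pose r : R := (2 * k%:R)^-1.
have r0 : 0 < r by rewrite invr_gt0 mulr_gt0.
have r12 : r <= 2^-1.
  by rewrite lef_pV2 ?posrE ?mulr_gt0 // ler_pMr // ler1n.
have [s [x [js [cs [Bs [b [ss br _ hl]]]]]]] := exists_play hS r0 r12 xi1 k 0.
have tl l : (l < k)%N ->
  turn (2 * r) (entry s l) (x l) (js l) (cs l) (Bs l) (b l).
  by move=> /hl[].
have /(_ (fun=> 1))/andP[+ _] : equiv_l1 C k x.
  by apply: hE => l lk; have [Sx /turn_norm] := hl l lk.
have -> : \sum_(i < k) `|1 : R| = k%:R by rewrite normr1 sumr_const card_ord.
suff : `|\sum_(i < k) (1 : R) *: x i| <= 13.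
  move=> h1 h2; have := le_trans h2 h1; rewrite mulrC ler_pdivrMr // => h3.
  by have := lt_le_trans kC h3; rewrite ltxx.
have -> : \sum_(i < k) (1 : R) *: x i =
    \sum_(i < k) (x i - b i *: lincomb e (scaled (js i) (cs i))) +
    \sum_(i < k) b i *: lincomb e (scaled (js i) (cs i)).
  by rewrite -big_split /=; apply: eq_bigr => i _; rewrite scale1r subrK.
apply: le_trans (ler_normD _ _) _.
have -> : 13 = 1 + 3 * 2 * 2 :> R by ring.
apply: lerD.
  apply: le_trans (ler_norm_sum _ _ _) _.
  apply: le_trans; first by apply: ler_sum => i _;
    exact: turn_close (tl i (ltn_ord i)).
  rewrite sumr_const card_ord -mulr_natr /r le_eqVlt; apply/orP; left;
    apply/eqP.
  by field; rewrite gt_eqF.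
pose K := \max_(i < k) Bs i.
have U := @norm_upper_bound _ _ _ _ hmn _ hsigma _ _ _ hX s K cs b 2 2 js.
rewrite ss in U; apply: U => //.
- by move=> i ik; apply: br; rewrite ss.
- by move=> i /tl/turn_index.
- move=> i ik q Kq; apply: (turn_bound (tl i ik)).
  by apply: leq_ltn_trans Kq; exact: (leq_bigmax (Ordinal ik)).
- by move=> i /tl/turn_mass.
- by move=> i /tl/turn_small h E; exact: h.
- by move=> i /tl/turn_supp.
- by move=> i /tl/turn_scalar.
Qed.

End Branches.

(* For xi = 0 all weights of T_xi equal m_1, so W is stable under the averages
   (1/2) sum f_i and the space is Asymptotic l_1: the last assertion needs
   xi >= 1. *)
Theorem theorem4p22 (R : realType)
    (lad : cord -> posnat -> cord) (hlad : is_ladder lad)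
    (m n : nat -> nat) (hmn : is_weights R m n)
    (sigma : seq wfun -> nat) (hsigma : is_coding m sigma)
    (xi : cord)
    (X : completeNormedModType R) (e : posnat -> X)
    (hX : is_completion (normW lad m n sigma xi) e)
    (M : set posnat) (hM : infinite_set M) :
  (exists T : set (seq (posnat -> R)), c0_tree e M (omega_pow xi) T) /\
  (cle (cnat 1) xi -> ~ asymptotic_l1 (closed_span e M)).
Proof.
have [Pv [cv [Bv hcv]]] := averages_exist hlad hmn hM.
have [code hcode] := infinite_coding hM.
split; last exact: (not_asymptotic_l1 hlad hmn hsigma hM hcv hX).
by eexists; exact: (vector_tree_c0 hlad hmn hsigma hcv hcode hX).
Qed.
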